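(* Let $\mathbf{t}(\omega,P)$ be a universal uniform test on $\Omega\times\mathcal{M}(\Omega)$ and $\mathbf{t}(\omega,p)$ a universal uniform Bernoulli test on $\Omega\times[0,1]$. Then $\mathbf{t}(\omega,B_p)\doteq\mathbf{t}(\omega,p)$, i.e. there is $c>0$ such that $c^{-1}\mathbf{t}(\omega,p)\le\mathbf{t}(\omega,B_p)\le c\,\mathbf{t}(\omega,p)$ for all $\omega\in\Omega$, $p\in[0,1]$.
   Context: $\Omega=\{0,1\}^{\mathbb{N}}$; $B_p$ is the Bernoulli measure with parameter $p$. $\mathcal{M}(\Omega)$ is the space of probability measures on $\Omega$, with basic sets given by finitely many conditions $u<P(y)<v$ ($y$ a word, $u,v$ rational, $P(y)=P(y\Omega)$); basic open sets of $\Omega\times\mathcal{M}(\Omega)$ are $x\Omega\times\beta$ ($x\Omega$ = sequences with prefix $x$). Basic open sets of $\Omega\times[0,1]$ are $x\Omega\times((u,v)\cap[0,1])$ with rational $u<v$. A function into $[0,\infty]$ on such a product is lower semicomputable if for each rational $r$ the set where it exceeds $r$ is the union of an enumerable family of basic open sets, uniformly in $r$. A uniform test is a lower semicomputable $t(\omega,P)\ge0$ with $\int t(\omega,P)\,dP(\omega)\le1$ for every $P$; a uniform Bernoulli test is a lower semicomputable $t(\omega,p)\ge0$ with $\int t(\omega,p)\,dB_p(\omega)\le1$ for every $p\in[0,1]$. Universal means maximal within the class up to a multiplicative constant (both exist). *)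

(* Defs.v *)
From HB Require Import structures.
From mathcomp Require Import all_boot all_order all_algebra.
From mathcomp Require Import interval_inference.
From mathcomp Require Import all_classical all_reals all_analysis.
From mathcomp Require Import measurable_realfun.
From mathcomp Require Import ring lra.

Set Implicit Arguments.
Unset Strict Implicit.
Unset Printing Implicit Defensive.
Import Order.TTheory GRing.Theory Num.Theory.
Import numFieldNormedType.Exports.

Local Open Scope classical_set_scope.
Local Open Scope ring_scope.

(* Programs for n-ary partial (mu-)recursive functions. *)
Inductive recf : nat -> Type :=
| RZero n : recf n
| RSucc : recf 1
| RProj n (i : 'I_n) : recf n
| RComp k n (f : recf k) (g : 'I_k -> recf n) : recf n
| RPrim n (f : recf n) (g : recf n.+2) : recf n.+1
| RMu n (f : recf n.+1) : recf n.

(* [recf_eval f x y]: the program [f] halts on input [x] with output [y]. *)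
Fixpoint recf_eval n (f : recf n) : n.-tuple nat -> nat -> Prop :=
  match f in recf n return n.-tuple nat -> nat -> Prop with
  | RZero _ => fun _ y => y = 0%N
  | RSucc => fun x y => y = (thead x).+1
  | RProj _ i => fun x y => y = tnth x i
  | RComp k _ f g => fun x y =>
      exists2 z : k.-tuple nat,
        (forall i, recf_eval (g i) x (tnth z i)) & recf_eval f z y
  | RPrim _ f g => fun x y =>
      let a := [tuple of behead x] in
      (fix loop m v := match m with
        | 0 => recf_eval f a v
        | k.+1 =>
            exists2 u, loop k u & recf_eval g [tuple of k :: u :: a] v
        end) (thead x) y
  | RMu _ f => fun x y =>
      recf_eval f [tuple of y :: x] 0%N /\
      forall z, (z < y)%N -> exists u, recf_eval f [tuple of z :: x] u.+1
  end.

(* Ranges of unary partial recursive functions, through the coding [pickle] of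
   [T] by natural numbers. This is the usual notion only when that coding is
   effective, as it is for the types used below, built from [bool] and [rat]
   by pairs and finite sequences. *)
Definition enumerable (T : countType) (A : set T) : Prop :=
  exists f : recf 1,
    forall a, A a <-> exists n, recf_eval f [tuple n] (pickle a).

(* [basic] lists the basic open sets of [X]. Uniformity in [r] is enumerability
   of the set of pairs [(r, b)] with [b] in the family [E r]. *)
Definition lower_semicomputable (R : realType) (X : Type) (B : countType)
    (basic : B -> set X) (f : X -> \bar R) : Prop :=
  exists2 E : rat -> set B,
    enumerable [set rb : rat * B | E rb.1 rb.2] &
    forall r, [set x | ((ratr r)%:E < f x)%E] = \bigcup_(b in E r) basic b.

Definition cylinder (x : seq bool) : set (nat -> bool) :=
  [set w | forall i, (i < size x)%N -> w i = nth false x i].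

(* The Borel sigma-algebra of the Cantor space is generated by cylinders. *)
Definition Omega : measurableType _ := g_sigma_algebraType (range cylinder).

Lemma measurable_cylinder (x : seq bool) :
  measurable (cylinder x : set Omega).
Proof. by apply: sub_sigma_algebra; exists x. Qed.

Lemma cylinderI (x y : seq bool) : (size x <= size y)%N ->
  cylinder x `&` cylinder y = cylinder y \/ cylinder x `&` cylinder y = set0.
Proof.
move=> xy; have [E|/eqP ne] := eqVneq x (take (size x) y); [left|right].
  apply/setIidPr => w wy i ix; rewrite wy ?(leq_trans ix)//.
  by rewrite [in RHS]E nth_take.
apply/seteqP; split => // w [wx wy]; apply: ne.
apply: (@eq_from_nth _ false) => [|i ix]; first by rewrite size_takel.
by rewrite nth_take// -wx// wy// (leq_trans ix).
Qed.

Lemma cylinder_measure_unique (R : realType) (P Q : probability Omega R) :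
  (forall y, P (cylinder y) = Q (cylinder y)) ->
  forall A, measurable A -> P A = Q A.
Proof.
move=> PQ A mA.
apply: (@measure_unique _ R Omega (range cylinder `|` [set set0])
  (fun=> setT) _ _ _ _ P Q) => //.
- rewrite eqEsubset; split.
    by apply: sub_sigma_algebra2; exact: subsetUl.
  apply: smallest_sub; first exact: sigma_algebra_measurable.
  by move=> _ [[x _ <-]|->]; [exact: measurable_cylinder|exact: measurable0].
- move=> _ _ [[x _ <-]|->] [[y _ <-]|->]; rewrite ?set0I ?setI0; try by right.
  case/orP: (leq_total (size x) (size y)) => [xy|yx].
    by case: (cylinderI xy) => ->; [left; exists y|right].
  by rewrite setIC; case: (cylinderI yx) => ->; [left; exists x|right].
- by move=> _; left; exists [::] => //; apply/seteqP; split => // w _ i.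
- by apply: bigcup_const; exists 0%N.
- by move=> _ [[x _ <-]|->]; [exact: PQ|rewrite !measure0].
- move=> _; have /= -> := @probability_setT _ _ _ P; exact: ltry.
Qed.

Section bernoulli.
Variables (R : realType) (p : {i01 R}).
Local Notation q := (p%:num : R).

(* Existence: [coding_digits] pushes the Lebesgue measure on [0, 1[ forward to
   the Bernoulli measure. Division by 0 is harmless: if [q = 1] the first branch
   is not taken on [0, 1[, if [q = 0] the second is not. *)
Definition coding_shift (x : R) : R :=
  if x < 1 - q then x / (1 - q) else (x - (1 - q)) / q.
Definition coding_digits (x : measurableTypeR R) : Omega :=
  fun n => 1 - q <= iter n coding_shift x.

Let measurable_shift : measurable_fun setT coding_shift.
Proof.
apply: measurable_fun_if => //.
- exact: measurable_fun_ltr.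
- by apply: measurable_funTS; apply: measurable_funM.
- by apply: measurable_funTS; apply: measurable_funM => //;
    apply: measurable_funB.
Qed.

Let measurable_iter n : measurable_fun setT (iter n coding_shift).
Proof.
elim: n => [|n ih]; first exact: measurable_id.
exact: (measurableT_comp measurable_shift ih).
Qed.

Let measurable_digits : measurable_fun setT coding_digits.
Proof.
apply: (@measurability _ _ _ Omega _ _ (range cylinder)) => //.
move=> _ [_ [x _ <-] <-].
rewrite setTI.
have -> : coding_digits @^-1` cylinder x =
    \bigcap_(i in [set i | (i < size x)%N])
      [set r | (1 - q <= iter i coding_shift r) = nth false x i].
  by apply/seteqP; split => r.
apply: bigcap_measurableType => i _.
have mb : measurable_fun setT (fun r => 1 - q <= iter i coding_shift r).
  by apply: measurable_fun_ler => //; exact: measurable_iter.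
have /= := mb measurableT [set nth false x i].
by rewrite setTI; apply.
Qed.

HB.instance Definition _ :=
  @isMeasurableFun.Build _ _ _ _ coding_digits measurable_digits.

Definition unit_measure : set (measurableTypeR R) -> \bar R :=
  mrestr (@lebesgue_measure R) (measurable_itv `[(0:R), 1[).

Let unit_measureT : unit_measure setT = 1%E.
Proof.
rewrite /unit_measure /mrestr setTI lebesgue_measure_itv /=.
by rewrite lte_fin ltr01 oppr0 adde0.
Qed.

HB.instance Definition _ := Measure.on unit_measure.
HB.instance Definition _ :=
  @Measure_isProbability.Build _ _ R unit_measure unit_measureT.

Let mass (y : seq bool) : R := \prod_(b <- y) bernoulli_pmf q b.

Fixpoint coding_left (y : seq bool) : R :=
  if y is b :: y' then
    if b then 1 - q + q * coding_left y' else (1 - q) * coding_left y'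
  else 0.

Let q0 : 0 <= q. Proof. by []. Qed.
Let q1 : q <= 1. Proof. by []. Qed.

Let mass_cons b y : mass (b :: y) = (if b then q else 1 - q) * mass y.
Proof. by rewrite /mass big_cons. Qed.

Let mass_ge0 y : 0 <= mass y.
Proof.
by apply: prodr_ge0 => b _; apply: bernoulli_pmf_ge0; rewrite q0 q1.
Qed.

Let left_ge0 y : 0 <= coding_left y.
Proof.
elim: y => //= -[] y ih; last by rewrite mulr_ge0 ?subr_ge0.
by rewrite addr_ge0 ?subr_ge0 ?mulr_ge0.
Qed.

Let right_le1 y : coding_left y + mass y <= 1.
Proof.
elim: y => [|b y ih]; first by rewrite /mass big_nil /= add0r.
rewrite mass_cons /=; have := q0; have := q1; move: ih.
move: (p%:num) (mass y) (coding_left y) => r m a ? ? ?.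
by case: b; nra.
Qed.

Let cylinder_cons b y (w : Omega) :
  cylinder (b :: y) w <-> w 0%N = b /\ cylinder y (fun n => w n.+1).
Proof.
split=> [wby|[w0 wy]]; first by split=> [|i iy]; [exact: (wby 0%N)|exact: wby].
by case=> [|i] // iy; exact: wy.
Qed.

Let digits_cylinder y x : 0 <= x < 1 ->
  cylinder y (coding_digits x) <-> coding_left y <= x < coding_left y + mass y.
Proof.
elim: y x => [|b y ih] x x01.
  by rewrite /mass big_nil /= add0r x01; split => // _ i.
rewrite cylinder_cons mass_cons.
have -> : (fun n => coding_digits x n.+1) = coding_digits (coding_shift x).
  by apply/funext => n; rewrite /coding_digits iterSr.
have m0 := mass_ge0 y; have a0 := left_ge0 y; have r1 := right_le1 y.
have -> : coding_digits x 0%N = (1 - q <= x) by [].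
have [C CE] : exists C, forall z, C z = cylinder y (coding_digits z).
  by eexists.
rewrite -CE /coding_shift /=; have {}ih z : 0 <= z < 1 ->
    C z <-> coding_left y <= z < coding_left y + mass y.
  by rewrite CE; exact: ih.
move: ih m0 a0 r1 q0 q1 => {CE}.
move: (mass y) (coding_left y) (p%:num) => m a r ih m0 a0 r1 r0 r1'.
case/andP: x01 => x0 x1; case: (ltP x (1 - r)) => xr.
  have r1'' : 0 < 1 - r by lra.
  have : x = (x / (1 - r)) * (1 - r) by rewrite divfK// gt_eqF.
  move: (x / (1 - r)) => z E.
  have z0 : 0 <= z by nra.
  have z1 : z < 1 by nra.
  have {}ih : C z <-> a <= z < a + m by apply: ih; rewrite z0 z1.
  case: b; split.
  - by case.
  - by move=> /andP[? ?]; exfalso; nra.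
  - by move=> [_ /ih/andP[? ?]]; apply/andP; split; nra.
  - by move=> /andP[? ?]; split=> //; apply/ih/andP; split; nra.
have r0' : 0 < r by lra.
have : x = 1 - r + (x - (1 - r)) / r * r by rewrite divfK ?gt_eqF//; lra.
move: ((x - (1 - r)) / r) => z E.
have z0 : 0 <= z by nra.
have z1 : z < 1 by nra.
have {}ih : C z <-> a <= z < a + m by apply: ih; rewrite z0 z1.
case: b; split.
- by move=> [_ /ih/andP[? ?]]; apply/andP; split; nra.
- by move=> /andP[? ?]; split=> //; apply/ih/andP; split; nra.
- by case.
- by move=> /andP[? ?]; exfalso; nra.
Qed.

Lemma bernoulli_exists : exists P : probability Omega R,
  forall y, P (cylinder y) = (\prod_(b <- y) bernoulli_pmf q b)%:E.
Proof.
exists (distribution unit_measure coding_digits) => y.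
rewrite /distribution /pushforward /= /unit_measure /mrestr.
have -> : coding_digits @^-1` cylinder y `&` `[0, 1[ =
    `[coding_left y, coding_left y + mass y[%classic.
  apply/seteqP; split => x /=; rewrite !in_itv /=.
    by move=> [/[swap] x01 /(digits_cylinder _ x01)].
  move=> xI; have x01 : 0 <= x < 1.
    have a0 := left_ge0 y; have r1 := right_le1 y.
    by case/andP: xI => ? ?; apply/andP; split; lra.
  by split=> //; apply/(digits_cylinder _ x01).
rewrite lebesgue_measure_itv /= lte_fin; case: ltP => [_|ml].
  by rewrite -EFinB addrAC subrr add0r.
congr EFin; apply/eqP; rewrite eq_le -/(mass y) mass_ge0 /=.
by move: ml; lra.
Qed.

Definition bernoulli : probability Omega R := projT1 (cid bernoulli_exists).

Lemma bernoulliE y :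
  bernoulli (cylinder y) = (\prod_(b <- y) bernoulli_pmf q b)%:E.
Proof. exact: (projT2 (cid bernoulli_exists)). Qed.

End bernoulli.

Section tests.
Variable R : realType.

(* Basic open sets of [Omega * M(Omega)] are coded by a word and a finite list
   of conditions [u < P(y) < v]. *)
Definition measure_basic
    (b : seq bool * seq (seq bool * rat * rat)) :
    set (Omega * probability Omega R) :=
  [set wP : Omega * probability Omega R | cylinder b.1 wP.1 /\
    forall (y : seq bool) (u v : rat), (y, u, v) \in b.2 ->
      ((ratr u)%:E < wP.2 (cylinder y) < (ratr v)%:E)%E].

(* Codes with [v <= u] denote the empty set. *)
Definition bernoulli_basic (b : seq bool * rat * rat) :
    set (Omega * {i01 R}) :=
  [set wp : Omega * {i01 R} | let: (x, u, v) := b in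
    cylinder x wp.1 /\ ratr u < wp.2%:num < ratr v].

Definition uniform_test (t : Omega * probability Omega R -> \bar R) : Prop :=
  [/\ lower_semicomputable measure_basic t,
      forall wP, (0 <= t wP)%E &
      forall P : probability Omega R, (\int[P]_w t (w, P) <= 1)%E].

Definition uniform_bernoulli_test (t : Omega * {i01 R} -> \bar R) : Prop :=
  [/\ lower_semicomputable bernoulli_basic t,
      forall wp, (0 <= t wp)%E &
      forall p : {i01 R}, (\int[bernoulli p]_w t (w, p) <= 1)%E].

Definition universal (X : Type) (C : set (X -> \bar R)) (t : X -> \bar R) :
    Prop :=
  C t /\ forall s, C s -> exists2 c : R, 0 < c &
    forall x, (s x <= c%:E * t x)%E.

End tests.

(* Main.v *)
(** Restricting a uniform test to the Bernoulli measures gives a uniform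
    Bernoulli test, because [p |-> B_p(y)] is a polynomial that can be bounded
    effectively on rational intervals.

    Conversely, let [t] be a uniform Bernoulli test, and let
    [e = (r, x, u, v)] range over the enumerated items with [t > r] on
    [x Omega * (u, v)] and [r > 0].  For a measure [P] with [p = P(1)], keep
    only the items with [u < p < v] and [P(x) < B_p(x) + eps_e], where
    [r * eps_e <= 2^-n] for the code [n] of [e], and take the supremum of the
    [r / 4] over the kept items whose word is a prefix of [w].  The second
    condition is void when [P = B_p], so this extends [t / 4].  A finite
    maximum of functions [r_i 1_{x_i}] is a combination of the [1_{x_i}] with
    coefficients in [[0, r_i]], so passing from [B_p] to [P] increases the
    integral by at most [sum r_i eps_i / 4], and the extension is a uniform
    test. *)

Require Import Defs.
From mathcomp Require Import all_boot all_order all_algebra.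
From mathcomp Require Import interval_inference.
From mathcomp Require Import all_classical all_reals all_analysis.
From mathcomp Require Import measurable_realfun.
From mathcomp Require Import ring lra zify.

Set Implicit Arguments.
Unset Strict Implicit.
Unset Printing Implicit Defensive.
Import Order.TTheory GRing.Theory Num.Theory.

Local Open Scope classical_set_scope.

(** * Recursive functions *)

Section recursive.

(** The function [t (w, P(1))] alone need not be a test: nothing bounds its integral under a measure
    [P] far from Bernoulli. The condition [P(x) < B_p(x) + eps_e] removes the items to which [P]
    gives too much mass. It is strict, so that keeping an item is a semidecidable event depending on
    finitely many values of [P], and the slack makes it hold with a margin at [P = B_p]. It is
    one-sided because the coefficients of the indicators are nonnegative: only an excess of [P] over
    [B_p] can increase the integral. The factor [4] pays for the slack: the integral under [B_p] is
    at most [1/4], and the weights [2^-n] add at most [2/4].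

    Enumerability is defined by actual programs acting on codes, so each new family of basic sets is
    obtained from a given one through a total recursive check ([enumerable_image]). The checks
    compare natural numbers only; real quantities such as [B_p(x)] enter them through rational
    bounds valid on a rational interval around [p]. *)

Definition total_recursive n (F : n.-tuple nat -> nat) : Prop :=
  exists f : recf n, forall x y, recf_eval f x y <-> y = F x.

Definition recursive1 (h : nat -> nat) :=
  total_recursive (fun x : 1.-tuple nat => h (thead x)).
Definition recursive2 (h : nat -> nat -> nat) :=
  total_recursive (fun x : 2.-tuple nat => h (tnth x 0%R) (tnth x 1%R)).
Definition recursive3 (h : nat -> nat -> nat -> nat) :=
  total_recursive (fun x : 3.-tuple nat =>
    h (tnth x 0%R) (tnth x 1%R) (tnth x 2%R)).

Lemma eq_total_recursive n (F G : n.-tuple nat -> nat) :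
  F =1 G -> total_recursive F -> total_recursive G.
Proof. by move=> FG [f fP]; exists f => x y; rewrite fP FG. Qed.

Lemma total_recursive_proj n (i : 'I_n) :
  total_recursive (fun x : n.-tuple nat => tnth x i).
Proof. by exists (RProj i). Qed.

Lemma total_recursive_comp k n (F : k.-tuple nat -> nat)
    (G : 'I_k -> n.-tuple nat -> nat) :
  total_recursive F -> (forall i, total_recursive (G i)) ->
  total_recursive (fun x => F [tuple G i x | i < k]).
Proof.
move=> [f fP] /choice[g gP]; exists (RComp f g) => x y /=; split.
  move=> [z zP /fP ->]; congr F; apply: eq_from_tnth => i.
  by rewrite tnth_mktuple; apply/gP.
move=> ->; exists [tuple G i x | i < k]; last exact/fP.
by move=> i; rewrite tnth_mktuple; apply/gP.
Qed.

Section application.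
Variables (n : nat) (F G : n.-tuple nat -> nat).
Hypotheses (Fr : total_recursive F) (Gr : total_recursive G).

Lemma total_recursive_app1 h : recursive1 h ->
  total_recursive (fun x => h (F x)).
Proof.
move=> hr; have := total_recursive_comp hr (fun=> Fr).
by apply: eq_total_recursive => x; rewrite /thead tnth_mktuple.
Qed.

Lemma total_recursive_app2 h : recursive2 h ->
  total_recursive (fun x => h (F x) (G x)).
Proof.
move=> hr; pose K := tnth [tuple F; G].
have Kr i : total_recursive (K i).
  by case: i => [[|[|//]] ?]; rewrite /K (tnth_nth F).
have := total_recursive_comp hr Kr.
by apply: eq_total_recursive => x; rewrite !tnth_mktuple.
Qed.

End application.

Lemma recursive1_id : recursive1 id.
Proof. exact: total_recursive_proj. Qed.

Lemma recursive1_succ : recursive1 succn.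
Proof. by exists RSucc. Qed.

Lemma total_recursive_const n c : total_recursive (fun _ : n.-tuple nat => c).
Proof.
elim: c => [|c ih]; first by exists (RZero n).
exact: (total_recursive_app1 ih recursive1_succ).
Qed.

Lemma recursive2_primrec (b : nat -> nat) (s : nat -> nat -> nat -> nat) :
  recursive1 b -> recursive3 s ->
  recursive2 (fun m a => nat_rect (fun=> nat) (b a) (fun k u => s k u a) m).
Proof.
move=> [f fP] [g gP]; exists (RPrim f g) => x y.
(* Names the anonymous fixpoint of [recf_eval], so that the induction on [m] can be stated. *)
pose loop (a : 1.-tuple nat) := fix loop m v := match m with
  | 0 => recf_eval f a v
  | k.+1 => exists2 u, loop k u & recf_eval g [tuple of k :: u :: a] v
  end.
have -> : recf_eval (RPrim f g) x y = loop [tuple of behead x] (thead x) y.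
  by [].
have -> : tnth x 0%R = thead x by [].
have -> : tnth x 1%R = thead [tuple of behead x].
  by case: x => -[|u [|v [|]]].
move: (thead x) [tuple of behead x] => {x} m a.
elim: m y => [|m ih] y /=; first exact: fP.
have e u v : recf_eval g [tuple of m :: u :: a] v <-> v = s m u (thead a).
  by rewrite gP; case: a {ih} => -[|? [|]].
split=> [[u /ih -> /e //]|->].
by eexists; [apply/ih|apply/e].
Qed.

(** A function characterized as a least zero becomes recursive without a recursive definition; [RMu]
    also asks for nonzero values below the zero, which the second clause supplies. *)
Lemma recursive1_mu (P : nat -> nat -> nat) (h : nat -> nat) :
  recursive2 P ->
  (forall a, P (h a) a = 0 /\ forall z, (z < h a)%N -> P z a != 0) ->
  recursive1 h.
Proof.
move=> [f fP] hP; exists (RMu f) => x y /=.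
have fE z u : recf_eval f [tuple of z :: x] u <-> u = P z (thead x).
  by rewrite fP; case: x => -[|? [|]].
have [h0 hmin] := hP (thead x); split=> [[/fE y0 ymin]|->].
  have [lt|lt|//] := ltngtP y (h (thead x)).
    by have := hmin _ lt; rewrite -y0.
  by have [u /fE] := ymin _ lt; rewrite h0.
split=> [|z /hmin]; first exact/fE.
by case E: (P z (thead x)) => [//|u] _; exists u; apply/fE.
Qed.

Let app1 := total_recursive_app1.
Let app2 := total_recursive_app2.
Let proj := total_recursive_proj.
Let const := total_recursive_const.

Lemma recursive2_add : recursive2 addn.
Proof.
have := @recursive2_primrec id (fun _ u _ => u.+1) recursive1_id
  (app1 (proj 1%R) recursive1_succ).
by apply: eq_total_recursive => x /=; elim: (tnth x 0%R) => //= m ->.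
Qed.

Lemma recursive2_mul : recursive2 muln.
Proof.
have := @recursive2_primrec (fun=> 0) (fun _ u a => a + u) (const 1 0)
  (app2 (proj 2%R) (proj 1%R) recursive2_add).
by apply: eq_total_recursive => x /=; elim: (tnth x 0%R) => //= m ->;
  rewrite mulSn.
Qed.

Lemma recursive1_pred : recursive1 predn.
Proof.
have r2 := @recursive2_primrec (fun=> 0) (fun k _ _ => k) (const 1 0)
  (proj (0%R : 'I_3)).
have := app2 (proj (0%R : 'I_1)) (proj (0%R : 'I_1)) r2.
by apply: eq_total_recursive => x /=; rewrite /thead; case: (tnth x _).
Qed.

Lemma recursive2_sub : recursive2 subn.
Proof.
have r2 := @recursive2_primrec id (fun _ u _ => u.-1) recursive1_id
  (app1 (proj 1%R) recursive1_pred).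
have := app2 (proj (1%R : 'I_2)) (proj (0%R : 'I_2)) r2.
apply: eq_total_recursive => x /=.
by elim: (tnth x 1%R) => /= [|m ->]; rewrite ?subn0 ?subnS.
Qed.

Lemma recursive2_exp : recursive2 expn.
Proof.
have r2 := @recursive2_primrec (fun=> 1) (fun _ u a => a * u) (const 1 1)
  (app2 (proj 2%R) (proj 1%R) recursive2_mul).
have := app2 (proj (1%R : 'I_2)) (proj (0%R : 'I_2)) r2.
apply: eq_total_recursive => x /=.
by elim: (tnth x 1%R) => //= m ->; rewrite expnS.
Qed.

Lemma recursive2_iter f : recursive1 f -> recursive2 (fun m a => iter m f a).
Proof.
move=> fr; have := @recursive2_primrec id (fun _ u _ => f u) recursive1_id
  (app1 (proj 1%R) fr).
by apply: eq_total_recursive => x /=; elim: (tnth x 0%R) => //= m ->.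
Qed.

Lemma recursive2_sum g : recursive2 g ->
  recursive2 (fun m a => \sum_(k < m) g k a).
Proof.
move=> gr; have := @recursive2_primrec (fun=> 0) (fun k u a => u + g k a)
  (const 1 0) (app2 (proj 1%R) (app2 (proj 0%R) (proj 2%R) gr) recursive2_add).
apply: eq_total_recursive => x /=.
by elim: (tnth x 0%R) => [|m ih]; rewrite ?big_ord0// big_ord_recr /= ih.
Qed.

Lemma recursive1_half : recursive1 half.
Proof.
(* [c.+1 <= 2 * q.+1] first holds at [q = c./2], whatever the parity of [c]. *)
apply: (@recursive1_mu (fun q c => c.+1 - 2 * q.+1)).
  apply: app2 recursive2_sub; first exact: (app1 (proj _) recursive1_succ).
  apply: app2 recursive2_mul; first exact: const.
  exact: (app1 (proj _) recursive1_succ).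
by move=> c; split=> [|z]; lia.
Qed.

Lemma recursive1_odd : recursive1 (fun c => odd c).
Proof.
have : recursive1 (fun c => c - 2 * c./2).
  apply: app2 recursive2_sub; first exact: proj.
  apply: app2 recursive2_mul; first exact: const.
  exact: (app1 (proj _) recursive1_half).
by apply: eq_total_recursive => x; rewrite /thead; lia.
Qed.

(** [CodeSeq.code (n :: s)] is [2 ^ n * (2 * CodeSeq.code s + 1)]: the head is the exponent of [2],
    and [n.+1] halvings leave the code of the tail. Pairs are pickled as lists of length two. *)
Definition code_pair a b := CodeSeq.code [:: a; b].
Definition code_head c := head 0 (CodeSeq.decode c).
Definition code_tail c := CodeSeq.code (behead (CodeSeq.decode c)).

Lemma code_head_cons n s : code_head (CodeSeq.code (n :: s)) = n.
Proof. by rewrite /code_head CodeSeq.codeK. Qed.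

Lemma code_tail_cons n s :
  code_tail (CodeSeq.code (n :: s)) = CodeSeq.code s.
Proof. by rewrite /code_tail CodeSeq.codeK. Qed.

Lemma code_head0 : code_head 0 = 0. Proof. by []. Qed.
Lemma code_tail0 : code_tail 0 = 0. Proof. by []. Qed.

Lemma code_eq0 s : (CodeSeq.code s == 0) = (s == [::]).
Proof. by case: s => //= n s; rewrite muln_eq0 expn_eq0. Qed.

Lemma code_pairK1 a b : code_head (code_pair a b) = a.
Proof. exact: code_head_cons. Qed.

Lemma code_pairK2 a b : code_head (code_tail (code_pair a b)) = b.
Proof. by rewrite code_tail_cons code_head_cons. Qed.

Lemma recursive2_code_pair : recursive2 code_pair.
Proof.
have : recursive2 (fun a b => 2 ^ a * (2 * 2 ^ b).+1).
  apply: app2 recursive2_mul.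
    exact: (app2 (const _ _) (proj _) recursive2_exp).
  apply: app1 recursive1_succ; apply: app2 recursive2_mul; first exact: const.
  exact: (app2 (const _ _) (proj _) recursive2_exp).
apply: eq_total_recursive => x.
by rewrite /code_pair /= double0 muln1 mul2n.
Qed.

Lemma iter_half n m k : iter n half (2 ^ (n + k) * m) = 2 ^ k * m.
Proof.
elim: n => //= n ih; rewrite -iterS iterSr addSn expnS -mulnA mul2n doubleK.
exact: ih.
Qed.

Lemma recursive1_code_head : recursive1 code_head.
Proof.
(* Zero as soon as [z] halvings make [c] odd; the factor [c] gives head [0] to the code [0] of the
   empty list. *)
apply: (@recursive1_mu (fun z c => c * (1 - odd (iter z half c)))).
  apply: app2 recursive2_mul; first exact: proj.
  apply: app2 recursive2_sub; first exact: const.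
  apply: app1 recursive1_odd.
  by apply: app2 (recursive2_iter recursive1_half); exact: proj.
move=> c; rewrite -[c]CodeSeq.decodeK.
case: (CodeSeq.decode c) => [|n s]; first by rewrite code_head0.
rewrite code_head_cons /=; split=> [|z zn].
  by rewrite -{3}[n]addn0 iter_half mul1n /= odd_double muln0.
rewrite muln_eq0 !negb_or muln_eq0 expn_eq0 /= -(subnKC (ltnW zn)) iter_half.
by rewrite -[(n - z)%N]prednK ?subn_gt0// expnS -mulnA oddM.
Qed.

Lemma recursive1_code_tail : recursive1 code_tail.
Proof.
have : recursive1 (fun c => iter (code_head c).+1 half c).
  apply: app2 (recursive2_iter recursive1_half); last exact: proj.
  by apply: app1 recursive1_succ; apply: app1 recursive1_code_head; exact: proj.
apply: eq_total_recursive => x; rewrite -[thead x]CodeSeq.decodeK.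
case: (CodeSeq.decode _) => [|n s]; first by rewrite code_tail0.
rewrite code_tail_cons code_head_cons /= -{2}[n]addn0 iter_half mul1n.
by lia.
Qed.

End recursive.

(** * Computable functions between coded types *)

(** [h] is total, with arbitrary values outside the range of [pickle]. *)
Definition computable (T U : countType) (F : T -> U) : Prop :=
  exists2 h, recursive1 h & forall t, h (pickle t) = pickle (F t).

Section computable.
Implicit Types T U V : countType.

Let app1 := total_recursive_app1.
Let app2 := total_recursive_app2.
Let proj := total_recursive_proj.
Let const := total_recursive_const.

Lemma pickle_pair T U (x : T) (y : U) :
  pickle (x, y) = code_pair (pickle x) (pickle y).
Proof. by []. Qed.

Lemma pickle_seqE T (s : seq T) : pickle s = CodeSeq.code (map pickle s).
Proof. by []. Qed.

Lemma pickle_nat (n : nat) : pickle n = n.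
Proof. by []. Qed.

Lemma pickle_bool (b : bool) : pickle b = b.
Proof. by []. Qed.

Lemma pickle_inj T : injective (@pickle T).
Proof. exact: pcan_inj pickleK. Qed.

Lemma computable_id T : computable (@id T).
Proof. by exists id => //; exact: recursive1_id. Qed.

Lemma computable_const T U (u : U) : computable (fun _ : T => u).
Proof. by exists (fun=> pickle u) => //; exact: const. Qed.

Lemma computable_comp T U V (F : U -> V) (G : T -> U) :
  computable F -> computable G -> computable (fun t => F (G t)).
Proof.
move=> [f fr fP] [g gr gP]; exists (f \o g) => [|t]; last by rewrite /= gP fP.
exact: (app1 gr fr).
Qed.

Lemma computable_fst T U : computable (@fst T U).
Proof.
exists code_head; first exact: recursive1_code_head.
by case=> a b; rewrite pickle_pair code_pairK1.
Qed.

Lemma computable_snd T U : computable (@snd T U).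
Proof.
exists (code_head \o code_tail) => [|[a b]].
  exact: (app1 recursive1_code_tail recursive1_code_head).
by rewrite pickle_pair /= code_pairK2.
Qed.

Lemma computable_op2 T (h : nat -> nat -> nat) (F G : T -> nat) :
  recursive2 h -> computable F -> computable G ->
  computable (fun t => h (F t) (G t)).
Proof.
move=> hr [f fr fP] [g gr gP]; exists (fun c => h (f c) (g c)) => [|t].
  exact: (app2 fr gr hr).
by rewrite fP gP.
Qed.

Lemma computable_pair T U V (F : T -> U) (G : T -> V) :
  computable F -> computable G -> computable (fun t => (F t, G t)).
Proof.
move=> [f fr fP] [g gr gP]; exists (fun c => code_pair (f c) (g c)) => [|t].
  exact: (app2 fr gr recursive2_code_pair).
by rewrite fP gP.
Qed.

Lemma computable_leq T (F G : T -> nat) :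
  computable F -> computable G -> computable (fun t => F t <= G t).
Proof.
move=> [f fr fP] [g gr gP]; exists (fun c => 1 - (f c - g c)) => [|t].
  apply: app2 recursive2_sub; first exact: const.
  exact: (app2 fr gr recursive2_sub).
by rewrite fP gP pickle_bool !pickle_nat; lia.
Qed.

Lemma computable_ltn T (F G : T -> nat) :
  computable F -> computable G -> computable (fun t => F t < G t).
Proof.
move=> [f fr fP]; apply: computable_leq; exists (succn \o f) => [|t].
  exact: (app1 fr recursive1_succ).
by rewrite /= fP.
Qed.

Lemma computable_and T (F G : T -> bool) :
  computable F -> computable G -> computable (fun t => F t && G t).
Proof.
move=> [f fr fP] [g gr gP]; exists (fun c => f c * g c) => [|t].
  exact: (app2 fr gr recursive2_mul).
by rewrite fP gP !pickle_bool mulnb.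
Qed.

Lemma computable_neg T (F : T -> bool) :
  computable F -> computable (fun t => ~~ F t).
Proof.
move=> [f fr fP]; exists (fun c => 1 - f c) => [|t].
  exact: (app2 (const _ _) fr recursive2_sub).
by rewrite fP !pickle_bool; case: (F t).
Qed.

Lemma computable_or T (F G : T -> bool) :
  computable F -> computable G -> computable (fun t => F t || G t).
Proof.
move=> Fc Gc.
have -> : (fun t => F t || G t) = (fun t => ~~ (~~ F t && ~~ G t)).
  by apply/funext => t; rewrite negb_and !negbK.
by apply/computable_neg/computable_and; exact: computable_neg.
Qed.

Lemma computable_code T U (F : T -> U) :
  computable F -> computable (fun t => pickle (F t)).
Proof. by move=> [f fr fP]; exists f. Qed.

Lemma computable_eq T U (F G : T -> U) :
  computable F -> computable G -> computable (fun t => F t == G t).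
Proof.
move=> /computable_code Fc /computable_code Gc.
have -> : (fun t => F t == G t) = (fun t =>
    (pickle (F t) <= pickle (G t))%N && (pickle (G t) <= pickle (F t))%N).
  by apply/funext => t; rewrite -eqn_leq (inj_eq (@pickle_inj U)).
by apply: computable_and; exact: computable_leq.
Qed.

Lemma computable_behead T : computable (@behead T).
Proof.
exists code_tail; first exact: recursive1_code_tail.
by case=> [|x s] //; rewrite !pickle_seqE /= code_tail_cons.
Qed.

Lemma computable_head T (x0 : T) : computable (head x0).
Proof.
exists (fun c => code_head c + pickle x0 * (1 - c)) => [|[|x s]].
- apply: app2 recursive2_add; first exact: recursive1_code_head.
  apply: app2 recursive2_mul; first exact: const.
  by apply: app2 recursive2_sub; [exact: const|exact: proj].
- by rewrite /= pickle_seqE /= muln1.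
rewrite pickle_seqE /= code_head_cons.
have : CodeSeq.code (map pickle (x :: s)) != 0 by rewrite code_eq0.
by rewrite -lt0n -subn_eq0 => /eqP /= ->; rewrite muln0 addn0.
Qed.

Lemma size_le_code s : size s <= CodeSeq.code s.
Proof.
elim: s => //= n s ih; apply: (@leq_trans (1 * (CodeSeq.code s).*2.+1)).
  by rewrite mul1n; lia.
by rewrite leq_mul// expn_gt0.
Qed.

(** A list code is at least the length of the list, so a sum over [k < c] visits every entry.
    [1 - (1 - m)] is the sign of [m]; it discards the positions past the end, where the remaining
    code is [0]. *)
Lemma recursive2_count (h : nat -> nat -> bool) :
  recursive2 (fun c d => h c d) ->
  recursive2 (fun c d => count (h^~ d) (CodeSeq.decode c)).
Proof.
move=> hr; pose it k e := iter k code_tail (code_head e).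
pose g k e := (1 - (1 - it k e)) *
  h (code_head (it k e)) (code_head (code_tail e)).
have itr : recursive2 it.
  apply: app2 (recursive2_iter recursive1_code_tail); first exact: proj.
  exact: (app1 (proj _) recursive1_code_head).
have gr : recursive2 g.
  apply: app2 recursive2_mul.
    apply: app2 recursive2_sub; first exact: const.
    exact: (app2 (const _ _) itr recursive2_sub).
  apply: app2 hr; first exact: (app1 itr recursive1_code_head).
  apply: app1 recursive1_code_head; exact: (app1 (proj _) recursive1_code_tail).
have := app2 (proj (0%R : 'I_2)) (app2 (proj (0%R : 'I_2)) (proj 1%R)
  recursive2_code_pair) (recursive2_sum gr).
apply: eq_total_recursive => x /=; move: (tnth x 0%R) (tnth x 1%R) => {x} c d.
have key s m : size s <= m ->
    \sum_(k < m) (1 - (1 - iter k code_tail (CodeSeq.code s))) *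
      h (code_head (iter k code_tail (CodeSeq.code s))) d = count (h^~ d) s.
  elim: s m => [|x s ih] m.
    move=> _; apply: big1 => k _.
    by have -> : iter k code_tail (CodeSeq.code [::]) = 0 by
      elim: (val k) => //= ? ->.
  case: m => // m sm; rewrite big_ord_recl code_head_cons.
  have : CodeSeq.code (x :: s) != 0 by rewrite code_eq0.
  rewrite -lt0n -subn_eq0 => /eqP.
  rewrite [iter _ _ _]/= => ->; rewrite subn0 mul1n [RHS]/=.
  congr addn; rewrite -(ih m)//.
  by apply: eq_bigr => k _; rewrite /= -iterS iterSr code_tail_cons.
rewrite -(key _ c); last by rewrite -{2}[c]CodeSeq.decodeK size_le_code.
apply: eq_bigr => k _.
by rewrite /g /it code_pairK1 code_pairK2 CodeSeq.decodeK.
Qed.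

(** Stands in for quantification over a list: [all] is tested as the absence of counted failures. *)
Lemma computable_count T U (P : T -> U -> bool) :
  computable (fun x : T * U => P x.1 x.2) ->
  computable (fun x : seq T * U => count (P^~ x.2) x.1).
Proof.
move=> [h hr hP].
have h'r : recursive2 (fun c d => 0 < h (code_pair c d))%N.
  apply: eq_total_recursive (app2 (const 2 1) (app2 (const 2 1)
    (app1 recursive2_code_pair hr) recursive2_sub) recursive2_sub) => x.
  by case: (h _).
exists (fun e => count (fun c => 0 < h (code_pair c (code_head (code_tail e))))
  (CodeSeq.decode (code_head e))) => [|[s u]].
  exact: (app2 recursive1_code_head
    (app1 recursive1_code_tail recursive1_code_head) (recursive2_count h'r)).
rewrite pickle_pair code_pairK1 code_pairK2 pickle_seqE CodeSeq.codeK count_map.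
by apply: eq_count => t /=; rewrite -pickle_pair hP pickle_bool lt0b.
Qed.

(* A program enumerating a subset of [T] may also output numbers that code no
   element of [T]; they have to be filtered out before being processed. *)
Definition is_code T (c : nat) : bool := `[< exists t : T, pickle t = c >].

(** An input encodes an index for the program of [E] together with a candidate output, which is
    returned if the element of [E] found at the index passes [chk] with it. Candidates that code no
    [a] are harmless: [enumerable] looks only at outputs of the form [pickle a]. *)
Lemma enumerable_image T U (E : set T) (chk : T * U -> bool) :
  computable (is_code T) -> enumerable E -> computable chk ->
  enumerable [set a : U | exists2 e, E e & chk (e, a)].
Proof.
move=> [v vr vP] [f fP] [h hr hP].
(* Minimizing this function over [z] returns [m] if the test succeeds and
   diverges otherwise. *)
have [F FP] : recursive3 (fun z y m => (1 - v y * h (code_pair y m)) + (m - z)).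
  apply: app2 recursive2_add; last by apply: app2 recursive2_sub; exact: proj.
  apply: app2 recursive2_sub; first exact: const.
  apply: app2 recursive2_mul; first exact: (app1 (proj _) vr).
  by apply: app1 hr; apply: app2 recursive2_code_pair; exact: proj.
have [hd hdP] := recursive1_code_head; have [tl tlP] := recursive1_code_tail.
pose fhd := RComp f (fun=> hd).
exists (RComp (RMu F) (tnth [tuple fhd; tl])) => a /=.
have FE z (m : 2.-tuple nat) u : recf_eval F [tuple of z :: m] u <->
    u = (1 - v (tnth m 0%R) * h (code_pair (tnth m 0%R) (tnth m 1%R))) +
        (tnth m 1%R - z).
  by rewrite FP; case: m => -[|? [|? [|]]].
have vE (e : T) : v (pickle e) = 1.
  rewrite -(pickle_nat (pickle e)) vP pickle_bool /is_code.
  by case: asboolP => // -[]; exists e.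
split.
  move=> [e Ee ea]; have [n nP] := (fP e).1 Ee.
  exists (CodeSeq.code (n :: CodeSeq.decode (pickle a))).
  set c := CodeSeq.code _; exists [tuple pickle e; pickle a].
    case=> -[|[|//]] i; rewrite !(tnth_nth 0) (tnth_nth fhd) /=.
      by exists [tuple n] => // j; apply/hdP; rewrite code_head_cons [j]ord1.
    by apply/tlP; rewrite code_tail_cons CodeSeq.decodeK.
  have hE : v (pickle e) * h (code_pair (pickle e) (pickle a)) = 1.
    by rewrite vE -pickle_pair hP ea.
  have {}FE z u : u = pickle a - z -> recf_eval F [tuple of z ::
      [tuple pickle e; pickle a]] u.
    by move=> ->; apply/FE; rewrite !(tnth_nth 0) /= hE subnn.
  split=> [|z za]; first by apply: FE; rewrite subnn.
  by exists ((pickle a - z).-1); apply: FE; rewrite prednK// subn_gt0.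
move=> [n [m mP [/FE/esym/eqP]]].
rewrite addn_eq0 !subn_eq0 => /andP[h1 lea] mmin.
(* Were the candidate smaller than the output, the minimized function would already vanish at the
   candidate. *)
have m1 : tnth m 1%R = pickle a.
  apply/eqP; rewrite eqn_leq lea leqNgt; apply/negP => /mmin[u].
  by move=> /FE; rewrite subnn addn0; lia.
have := mP 0%R; rewrite (tnth_nth fhd) /= => -[k kP fk].
move: h1; rewrite muln_gt0 => /andP[v0 h0].
move: v0; rewrite -(pickle_nat (tnth m 0%R)) vP pickle_bool lt0b.
move=> /asboolP[e me]; exists e.
  apply/fP; exists (thead k); rewrite me; move: fk; congr recf_eval.
  by apply: eq_from_tnth => i; rewrite ord1.
by move: h0; rewrite -me m1 -pickle_pair hP pickle_bool lt0b.
Qed.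

Lemma computable_nat_of_bool T (F : T -> bool) :
  computable F -> computable (fun t => nat_of_bool (F t)).
Proof. by move=> [f fr fP]; exists f. Qed.

Lemma computable_sum T (M : T -> nat) (G : nat -> T -> nat) :
  computable M -> computable (fun x : nat * T => G x.1 x.2) ->
  computable (fun t => \sum_(k < M t) G k t).
Proof.
move=> [m mr mP] [g gr gP].
exists (fun c => \sum_(k < m c) g (code_pair k c)) => [|t].
  have gr2 : recursive2 (fun k c => g (code_pair k c)).
    exact: (app1 recursive2_code_pair gr).
  exact: (app2 mr recursive1_id (recursive2_sum gr2)).
rewrite mP !pickle_nat; apply: eq_bigr => k _.
by rewrite -(pickle_nat k) -pickle_pair gP.
Qed.

Lemma computable_dvdn T (F G : T -> nat) :
  computable F -> computable G -> computable (fun t => F t %| G t).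
Proof.
move=> Fc Gc.
have -> : (fun t => F t %| G t) =
    (fun t => 0 < \sum_(k < (G t).+1) (k * F t == G t))%N.
  apply/funext => t; rewrite lt0n sum_nat_eq0 negb_forall; apply/idP/idP.
    move=> dFG; apply/existsP; exists (inord (G t %/ F t)).
    by rewrite inordK ?ltnS ?leq_div// divnK// eqxx.
  by move=> /existsP[k]; rewrite eqb0 negbK => /eqP <-; exact: dvdn_mull.
apply: computable_ltn; first exact: computable_const.
apply: (@computable_sum _ _ (fun k t => k * F t == G t)).
  by move: Gc => [g gr gP]; exists (succn \o g) => [|t /=];
    [exact: (app1 gr recursive1_succ)|rewrite gP].
apply/computable_nat_of_bool/computable_eq.
  apply: computable_op2 recursive2_mul _ _; first exact: computable_fst.
  exact: computable_comp Fc (computable_snd _ _).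
exact: computable_comp Gc (computable_snd _ _).
Qed.

(** A gcd other than [1] is itself a common divisor [k.+2] with [k < n], where [0 < n] excludes gcd
    [0]; the sum is a computable form of this search. *)
Lemma coprime_sum m n : (0 < n)%N ->
  coprime m n = (\sum_(k < m + n) ((k.+2 %| m) && (k.+2 %| n)) == 0).
Proof.
move=> n0; rewrite sum_nat_eq0; apply/idP/forallP => [cmn k|h].
  rewrite implyTb eqb0 -dvdn_gcd (eqP cmn); apply/negP => /dvdn_leq.
  by move=> /(_ isT).
have g0 : (0 < gcdn m n)%N by rewrite gcdn_gt0 n0 orbT.
rewrite /coprime; case E: (gcdn m n) g0 => [//|[//|k]] _.
have kn : (k < m + n)%N.
  have /dvdn_leq : k.+2 %| n by rewrite -E dvdn_gcdr.
  by move=> /(_ n0); lia.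
by have := h (Ordinal kn); rewrite /= eqb0 -dvdn_gcd E dvdnn.
Qed.

Lemma computable_succ T (F : T -> nat) :
  computable F -> computable (fun t => (F t).+1).
Proof.
move=> [g gr gP]; exists (succn \o g) => [|t /=]; last by rewrite gP.
exact: (app1 gr recursive1_succ).
Qed.

Lemma computable_coprime T (F G : T -> nat) :
  (forall t, 0 < G t)%N ->
  computable F -> computable G -> computable (fun t => coprime (F t) (G t)).
Proof.
move=> G0 Fc Gc.
have -> : (fun t => coprime (F t) (G t)) = (fun t =>
  \sum_(k < F t + G t) ((k.+2 %| F t) && (k.+2 %| G t)) == 0).
  by apply/funext => t; rewrite coprime_sum.
apply: computable_eq; last exact: computable_const.
apply: (@computable_sum _ _ (fun k t => (k.+2 %| F t) && (k.+2 %| G t))).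
  exact: (computable_op2 recursive2_add).
have c1 : computable (fun x : nat * T => x.1.+2).
  by do 2!apply: computable_succ; exact: computable_fst.
apply/computable_nat_of_bool/computable_and; apply: computable_dvdn => //;
  by apply: computable_comp (computable_snd _ _).
Qed.

Lemma computable_code_head T (F : T -> nat) :
  computable F -> computable (fun t => code_head (F t)).
Proof.
by apply: computable_comp; exists code_head => //; exact: recursive1_code_head.
Qed.

Lemma computable_code_tail T (F : T -> nat) :
  computable F -> computable (fun t => code_tail (F t)).
Proof.
by apply: computable_comp; exists code_tail => //; exact: recursive1_code_tail.
Qed.

Lemma computable_code_pair T (F G : T -> nat) :
  computable F -> computable G -> computable (fun t => code_pair (F t) (G t)).
Proof. exact: computable_op2 recursive2_code_pair. Qed.

Lemma computable_code1 T (F : T -> nat) :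
  computable F -> computable (fun t => CodeSeq.code [:: F t]).
Proof.
have -> : (fun t => CodeSeq.code [:: F t]) = (fun t => 2 ^ F t).
  by apply/funext => t; rewrite /= double0 muln1.
by apply: (computable_op2 recursive2_exp); exact: computable_const.
Qed.

(** * Deciding which numbers are codes *)

Lemma is_code_bool : computable (is_code bool).
Proof.
have -> : is_code bool = (fun c => c <= 1).
  apply/funext => c; apply/asboolP/idP => [[b <-]|]; first by case: b.
  by case: c => [|[|//]] _; [exists false|exists true].
by apply: computable_leq; [exact: computable_id|exact: computable_const].
Qed.

Lemma is_code_pair T U : computable (is_code T) -> computable (is_code U) ->
  computable (is_code (T * U)%type).
Proof.
move=> Tc Uc.
have -> : is_code (T * U)%type = (fun c =>
    [&& c == code_pair (code_head c) (code_head (code_tail c)),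
        is_code T (code_head c) & is_code U (code_head (code_tail c))]).
  apply/funext => c; apply/asboolP/and3P => [[[t u] <-]|].
    rewrite pickle_pair code_pairK1 code_pairK2.
    by split=> //; apply/asboolP; [exists t|exists u].
  by move=> [/eqP cE /asboolP[t tE] /asboolP[u uE]]; exists (t, u);
    rewrite cE pickle_pair tE uE.
have hdc := computable_code_head (computable_id nat).
have tlc := computable_code_head (computable_code_tail (computable_id nat)).
apply: computable_and; last apply: computable_and.
- by apply: computable_eq; [exact: computable_id|exact: computable_code_pair].
- exact: computable_comp Tc hdc.
- exact: computable_comp Uc tlc.
Qed.

Lemma is_code_seq T : computable (is_code T) -> computable (is_code (seq T)).
Proof.
move=> [v vr vP].
have -> : is_code (seq T) = (fun c =>
    count (fun x => ~~ is_code T x) (CodeSeq.decode c) == 0).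
  apply/funext => c; apply/asboolP/idP => [[s <-]|].
    rewrite pickle_seqE CodeSeq.codeK count_map eqn0Ngt -has_count -all_predC.
    by apply/allP => t _ /=; rewrite negbK; apply/asboolP; exists t.
  rewrite eqn0Ngt -has_count -all_predC => /allP h.
  suff [s sE] : exists s : seq T, map pickle s = CodeSeq.decode c.
    by exists s; rewrite pickle_seqE sE CodeSeq.decodeK.
  elim: (CodeSeq.decode c) h => [|x s ih] h; first by exists [::].
  have [|s' <-] := ih; first by move=> y ys; apply: h; rewrite inE ys orbT.
  have := h x; rewrite inE eqxx /= negbK => /(_ isT)/asboolP[t <-].
  by exists (t :: s').
apply: computable_eq; last exact: computable_const.
exists (fun c => count (fun x => ~~ is_code T x) (CodeSeq.decode c)) => //.
have vr2 : recursive2 (fun c _ => ~~ is_code T c).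
  apply: eq_total_recursive (app2 (const 2 1) (app1 (proj 0%R) vr)
    recursive2_sub) => x.
  by have := vP (tnth x 0%R); rewrite pickle_nat => ->; case: is_code.
exact: (app2 recursive1_id (const 1 0) (recursive2_count vr2)).
Qed.

(** Integers are pickled through a sum type, coded as a pair of options; an option is coded as a
    list of length at most one. *)
Lemma pickle_Posz n : pickle (Posz n) = code_pair (CodeSeq.code [:: n]) 0.
Proof. by []. Qed.

Lemma pickle_Negz n : pickle (Negz n) = code_pair 0 (CodeSeq.code [:: n]).
Proof. by []. Qed.

Lemma pickle_rat (r : rat) :
  pickle r = code_pair (pickle (numq r)) (pickle (denq r)).
Proof. by []. Qed.

(** A rational is pickled as its reduced fraction, so recognizing a code means checking that the
    denominator is positive and coprime to the numerator, for either sign of the latter. *)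
Lemma is_code_rat : computable (is_code rat).
Proof.
pose num c := code_head c; pose den c := code_head (code_tail c).
pose pos c := code_head (code_head c).
pose neg c := code_head (code_head (code_tail c)).
have posE n : pos (pickle (Posz n)) = n.
  by rewrite /pos pickle_Posz code_pairK1 code_head_cons.
have negE n : neg (pickle (Negz n)) = n.
  by rewrite /neg pickle_Negz code_pairK2 code_head_cons.
(* [.-1.+1] fixes exactly the positive numbers, which forces a positive denominator. *)
have -> : is_code rat = (fun c => [&& c == code_pair (num c) (den c),
    den c == code_pair (CodeSeq.code [:: (pos (den c)).-1.+1]) 0 &
    (num c == code_pair (CodeSeq.code [:: pos (num c)]) 0) &&
      coprime (pos (num c)) (pos (den c)).-1.+1 ||
    (num c == code_pair 0 (CodeSeq.code [:: neg (num c)])) &&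
      coprime (neg (num c)).+1 (pos (den c)).-1.+1]).
  apply/funext => c; apply/asboolP/and3P => [[r <-]|].
    rewrite pickle_rat /num /den code_pairK1 code_pairK2.
    have := coprime_num_den r; have := denq_gt0 r.
    case: (denq r) => [[|d]|d] // _; rewrite posE [_.-1]/= -pickle_Posz.
    case: (numq r) => n cop; split=> //; first by rewrite posE eqxx cop.
    by rewrite negE eqxx cop orbT.
  move=> [/eqP cE /eqP dE nE].
  suff [n nP nC] : exists2 n : int, num c = pickle n &
      coprime `|n| (pos (den c)).-1.+1.
    exists (n%:~R / (Posz (pos (den c)).-1.+1)%:~R)%R.
    have -> : pickle (n%:~R / (Posz (pos (den c)).-1.+1)%:~R : rat)%R =
        code_pair (pickle n) (pickle (Posz (pos (den c)).-1.+1)).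
      by rewrite pickle_rat coprimeq_num// coprimeq_den// gtr0_sg// mul1r.
    by rewrite [RHS]cE nP [in RHS]dE pickle_Posz.
  case/orP: nE => /andP[/eqP nE nC]; first by exists (Posz (pos (num c))).
  by exists (Negz (neg (num c))).
have hdc := computable_code_head; have tlc := computable_code_tail.
have nc : computable num by apply/hdc; exact: computable_id.
have dc : computable den by apply/hdc/tlc; exact: computable_id.
have pnc : computable (fun c => pos (num c)) by do 2!apply/hdc.
have nnc : computable (fun c => neg (num c)) by do 2!apply/hdc; apply/tlc.
have pdc : computable (fun c => (pos (den c)).-1.+1).
  apply: computable_succ.
  apply: (@computable_comp _ nat _ predn) (hdc _ _ (hdc _ _ dc)).
  by exists predn => //; exact: recursive1_pred.
have cc := computable_code_pair; have c0 : computable (fun _ : nat => 0).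
  exact: computable_const.
apply: computable_and.
  by apply: computable_eq; [exact: computable_id|exact: cc].
apply: computable_and.
  by apply: computable_eq => //; apply: cc => //; exact: computable_code1.
apply: computable_or; (apply: computable_and; last first).
- exact: computable_coprime.
- by apply: computable_eq => //; apply: cc => //; exact: computable_code1.
- by apply: computable_coprime => //; exact: computable_succ.
- by apply: computable_eq => //; apply: cc => //; exact: computable_code1.
Qed.

End computable.

Local Open Scope ring_scope.

(** * Effective bounds for Bernoulli measures *)

(* [pnum r / pden r] is the positive part of [r], so that all tests below are
   comparisons of natural numbers. *)
Definition pnum (r : rat) : nat := if numq r is Posz n then n else 0%N.
Definition pden (r : rat) : nat := `|denq r|%N.

(* Fractions bounding [B_p(y)] from below and above for [a < p < b]. *)
Definition low_num (a b : rat) (y : seq bool) : nat :=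
  (pnum a ^ count id y * (pden b - pnum b) ^ count negb y)%N.
Definition low_den (a b : rat) (y : seq bool) : nat :=
  (pden a ^ count id y * pden b ^ count negb y)%N.
Definition high_num (a b : rat) (y : seq bool) : nat :=
  (minn (pnum b) (pden b) ^ count id y * (pden a - pnum a) ^ count negb y)%N.
Definition high_den (a b : rat) (y : seq bool) : nat :=
  (pden b ^ count id y * pden a ^ count negb y)%N.

(** [pnum] erases negative values. For [u < 0] the lower condition holds outright, the lower bound
    being nonnegative; for [v <= 0] the second comparison fails, as it should. *)
Definition bounds_check (c : seq bool * rat * rat) (ab : rat * rat) : bool :=
  let: (y, u, v) := c in let: (a, b) := ab in
  ((u < 0) || (pnum u * low_den a b y < low_num a b y * pden u)%N) &&
  (high_num a b y * pden v < pnum v * high_den a b y)%N.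

(* The enumerated basic set [(x, cs)] at level [r] contains [(w, B_p)] for all
   [w] in the cylinder of [x] and [a < p < b]. *)
Definition restriction_check
    (ea : (rat * (seq bool * seq (seq bool * rat * rat))) *
          (rat * (seq bool * rat * rat))) : bool :=
  let: ((r, (x, cs)), (r', (x', a, b))) := ea in
  [&& r' == r, x' == x & count (fun c => ~~ bounds_check c (a, b)) cs == 0%N].

(* Denominator of the slack [eps_e]: [r <= pnum r] gives
   [r * eps_e <= 2 ^ - pickle e]. *)
Definition tolerance_den (e : rat * (seq bool * rat * rat)) : nat :=
  (pnum e.1 * 2 ^ pickle e)%N.

(* Every [P] satisfying the conditions [cs] has [P(1)] in [(u, v)] and in
   [(a, b)], and [P(x) < h <= low_bound a b x + eps_e]. For [r' < 0] the basic
   set is arbitrary, the extended test being nonnegative. *)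
Definition extension_check
    (ea : (rat * (seq bool * rat * rat)) *
          (rat * (seq bool * seq (seq bool * rat * rat)))) : bool :=
  let: (e, (r', (x', cs))) := ea in
  let: (r, (x, u, v)) := e in
  let c0 : seq bool * rat * rat := ([::], 0, 0) in
  let c1 := head c0 cs in
  let c2 := head c0 (behead cs) in
  let c3 := head c0 (behead (behead cs)) in
  (r' < 0) || [&& (4 * pnum r' * pden r < pnum r * pden r')%N, x' == x,
    behead (behead cs) != [::], c1 == ([:: true], u, v), c2.1.1 == [:: true],
    c3.1.1 == x, c3.1.2 < 0 &
    (pnum c3.2 * (low_den c2.1.2 c2.2 x * tolerance_den e) <=
     (low_num c2.1.2 c2.2 x * tolerance_den e + low_den c2.1.2 c2.2 x) *
       pden c3.2)%N].

(** * Computability of the checks *)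

Section computable_checks.
Implicit Types T U V : countType.

Lemma computable_pnum T (F : T -> rat) :
  computable F -> computable (fun t => pnum (F t)).
Proof.
apply: computable_comp; exists (fun c => code_head (code_head (code_head c))).
  apply: total_recursive_app1 recursive1_code_head.
  exact: (total_recursive_app1 recursive1_code_head recursive1_code_head).
move=> r; rewrite pickle_rat code_pairK1 /pnum; case: (numq r) => n.
  by rewrite pickle_Posz code_pairK1 code_head_cons.
by rewrite pickle_Negz code_pairK1.
Qed.

Lemma computable_pden T (F : T -> rat) :
  computable F -> computable (fun t => pden (F t)).
Proof.
apply: computable_comp.
exists (fun c => code_head (code_head (code_head (code_tail c)))).
  do 2!apply: total_recursive_app1 recursive1_code_head.
  exact: (total_recursive_app1 recursive1_code_tail recursive1_code_head).
move=> r; rewrite pickle_rat code_pairK2 /pden; have := denq_gt0 r.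
case: (denq r) => n // _.
by rewrite pickle_Posz code_pairK1 code_head_cons.
Qed.

Lemma computable_rat_lt0 T (F : T -> rat) :
  computable F -> computable (fun t => F t < 0).
Proof.
move=> Fc; apply: (computable_comp (F := fun r : rat => r < 0)) Fc.
have -> : (fun r : rat => r < 0) =
    (fun r => code_head (code_head (pickle r)) == 0%N).
  apply/funext => r; rewrite pickle_rat code_pairK1 -numq_lt0.
  case: (numq r) => n.
    by rewrite pickle_Posz code_pairK1 code_eq0.
  by rewrite pickle_Negz code_pairK1.
apply: computable_eq; last exact: computable_const.
do 2!apply: computable_code_head; apply: computable_code.
exact: computable_id.
Qed.

Lemma computable_count_bits T (p : pred bool) (F : T -> seq bool) :
  computable p -> computable F -> computable (fun t => count p (F t)).
Proof.
move=> pc Fc.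
apply: (computable_comp
  (computable_count (P := fun b (_ : nat) => p b) (computable_comp pc _))
  (computable_pair Fc (computable_const _ 0%N))).
exact: computable_fst.
Qed.

Lemma computable_add T (F G : T -> nat) :
  computable F -> computable G -> computable (fun t => F t + G t)%N.
Proof. exact: computable_op2 recursive2_add. Qed.

Lemma computable_mul T (F G : T -> nat) :
  computable F -> computable G -> computable (fun t => F t * G t)%N.
Proof. exact: computable_op2 recursive2_mul. Qed.

Lemma computable_sub T (F G : T -> nat) :
  computable F -> computable G -> computable (fun t => F t - G t)%N.
Proof. exact: computable_op2 recursive2_sub. Qed.

Lemma computable_exp T (F G : T -> nat) :
  computable F -> computable G -> computable (fun t => F t ^ G t)%N.
Proof. exact: computable_op2 recursive2_exp. Qed.

Section bounds.
Variables (T : countType) (A B : T -> rat) (Y : T -> seq bool).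
Hypotheses (Ac : computable A) (Bc : computable B) (Yc : computable Y).

Let onesc : computable (fun t => count id (Y t)).
Proof. exact: computable_count_bits (computable_id _) Yc. Qed.

Let zerosc : computable (fun t => count negb (Y t)).
Proof.
exact: computable_count_bits (computable_neg (computable_id _)) Yc.
Qed.

Lemma computable_low_num : computable (fun t => low_num (A t) (B t) (Y t)).
Proof.
apply: computable_mul; apply: computable_exp => //.
  exact: computable_pnum.
by apply: computable_sub; [exact: computable_pden|exact: computable_pnum].
Qed.

Lemma computable_low_den : computable (fun t => low_den (A t) (B t) (Y t)).
Proof.
by apply: computable_mul; apply: computable_exp => //; exact: computable_pden.
Qed.

Lemma computable_high_num : computable (fun t => high_num (A t) (B t) (Y t)).
Proof.
apply: computable_mul; apply: computable_exp => //; last first.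
  by apply: computable_sub; [exact: computable_pden|exact: computable_pnum].
have -> : (fun t => minn (pnum (B t)) (pden (B t))) =
    (fun t => pnum (B t) - (pnum (B t) - pden (B t)))%N.
  by apply/funext => t; rewrite minnE.
have nc := computable_pnum Bc; have dc := computable_pden Bc.
by apply: computable_sub => //; exact: computable_sub.
Qed.

Lemma computable_high_den : computable (fun t => high_den (A t) (B t) (Y t)).
Proof.
by apply: computable_mul; apply: computable_exp => //; exact: computable_pden.
Qed.

End bounds.

Lemma computable_fst_comp T U V (F : T -> U * V) :
  computable F -> computable (fun t => (F t).1).
Proof. exact: computable_comp (computable_fst _ _). Qed.

Lemma computable_snd_comp T U V (F : T -> U * V) :
  computable F -> computable (fun t => (F t).2).
Proof. exact: computable_comp (computable_snd _ _). Qed.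

Let f1 := computable_fst_comp.
Let f2 := computable_snd_comp.

Lemma computable_bounds_check :
  computable (fun x : (seq bool * rat * rat) * (rat * rat) =>
    bounds_check x.1 x.2).
Proof.
have idc := computable_id ((seq bool * rat * rat) * (rat * rat))%type.
have yc := f1 (f1 (f1 idc)); have uc := f2 (f1 (f1 idc)).
have vc := f2 (f1 idc); have ac := f1 (f2 idc); have bc := f2 (f2 idc).
have -> : (fun x : (seq bool * rat * rat) * (rat * rat) =>
  bounds_check x.1 x.2) = (fun x =>
  ((x.1.1.2 < 0) || (pnum x.1.1.2 * low_den x.2.1 x.2.2 x.1.1.1 <
     low_num x.2.1 x.2.2 x.1.1.1 * pden x.1.1.2)%N) &&
  (high_num x.2.1 x.2.2 x.1.1.1 * pden x.1.2 <
   pnum x.1.2 * high_den x.2.1 x.2.2 x.1.1.1)%N).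
  by apply/funext => -[[[y u] v] [a b]].
apply: computable_and; [apply: computable_or|]; first exact: computable_rat_lt0.
  apply: computable_ltn; apply: computable_mul.
  - exact: computable_pnum.
  - exact: computable_low_den.
  - exact: computable_low_num.
  - exact: computable_pden.
apply: computable_ltn; apply: computable_mul.
- exact: computable_high_num.
- exact: computable_pden.
- exact: computable_pnum.
- exact: computable_high_den.
Qed.

Lemma computable_restriction_check : computable restriction_check.
Proof.
set T := ((rat * (seq bool * seq (seq bool * rat * rat))) *
          (rat * (seq bool * rat * rat)))%type.
have idc := computable_id T.
have -> : restriction_check = (fun t : T =>
   [&& t.2.1 == t.1.1, t.2.2.1.1 == t.1.2.1 &
    count (fun c => ~~ bounds_check c (t.2.2.1.2, t.2.2.2)) t.1.2.2 == 0%N]).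
  by apply/funext => -[[r [x cs]] [r' [[x' a] b]]].
apply: computable_and; last apply: computable_and.
- by apply: computable_eq; [exact: f1 (f2 idc)|exact: f1 (f1 idc)].
- apply: computable_eq; first exact: f1 (f1 (f2 (f2 idc))).
  exact: f1 (f2 (f1 idc)).
- apply: computable_eq; last exact: computable_const.
  apply: (computable_comp
    (computable_count (P := fun c ab => ~~ bounds_check c ab)
      (computable_neg computable_bounds_check))
    (computable_pair _ (computable_pair _ _))).
  + exact: f2 (f2 (f1 idc)).
  + exact: f2 (f1 (f2 (f2 idc))).
  + exact: f2 (f2 (f2 idc)).
Qed.

Lemma computable_extension_check : computable extension_check.
Proof.
set T := ((rat * (seq bool * rat * rat)) *
          (rat * (seq bool * seq (seq bool * rat * rat))))%type.
have idc := computable_id T.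
pose c0 : seq bool * rat * rat := ([::], 0, 0).
pose C1 (t : T) := head c0 t.2.2.2.
pose C2 (t : T) := head c0 (behead t.2.2.2).
pose C3 (t : T) := head c0 (behead (behead t.2.2.2)).
have csc : computable (fun t : T => t.2.2.2) by exact: f2 (f2 (f2 idc)).
have cs2c : computable (fun t : T => behead t.2.2.2).
  exact: computable_comp (computable_behead _) csc.
have cs3c : computable (fun t : T => behead (behead t.2.2.2)).
  exact: computable_comp (computable_behead _) cs2c.
have C1c : computable C1 by exact: computable_comp (computable_head _) csc.
have C2c : computable C2 by exact: computable_comp (computable_head _) cs2c.
have C3c : computable C3 by exact: computable_comp (computable_head _) cs3c.
have rc : computable (fun t : T => t.1.1) by exact: f1 (f1 idc).
have xc : computable (fun t : T => t.1.2.1.1) by exact: f1 (f1 (f2 (f1 idc))).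
have uc : computable (fun t : T => t.1.2.1.2) by exact: f2 (f1 (f2 (f1 idc))).
have vc : computable (fun t : T => t.1.2.2) by exact: f2 (f2 (f1 idc)).
have r'c : computable (fun t : T => t.2.1) by exact: f1 (f2 idc).
have x'c : computable (fun t : T => t.2.2.1) by exact: f1 (f2 (f2 idc)).
have tc : computable (fun t : T => tolerance_den t.1).
  apply: computable_mul; first exact: computable_pnum.
  apply: computable_exp; first exact: computable_const.
  by apply: computable_code; exact: f1 idc.
have a_c := f2 (f1 C2c); have bc := f2 C2c; have hc := f2 C3c.
have -> : extension_check = (fun t : T =>
  (t.2.1 < 0) || [&& (4 * pnum t.2.1 * pden t.1.1 < pnum t.1.1 * pden t.2.1)%N,
    t.2.2.1 == t.1.2.1.1, behead (behead t.2.2.2) != [::],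
    C1 t == ([:: true], t.1.2.1.2, t.1.2.2), (C2 t).1.1 == [:: true],
    (C3 t).1.1 == t.1.2.1.1, (C3 t).1.2 < 0 &
    (pnum (C3 t).2 * (low_den (C2 t).1.2 (C2 t).2 t.1.2.1.1 * tolerance_den t.1)
     <= (low_num (C2 t).1.2 (C2 t).2 t.1.2.1.1 * tolerance_den t.1 +
         low_den (C2 t).1.2 (C2 t).2 t.1.2.1.1) * pden (C3 t).2)%N]).
  by apply/funext => -[[r [[x u] v]] [r' [x' cs]]].
have kc (U : countType) (k : U) : computable (fun _ : T => k).
  exact: computable_const.
apply: computable_or; first exact: computable_rat_lt0.
apply: computable_and.
  apply: computable_ltn; repeat apply: computable_mul => //;
    by [exact: computable_pnum|exact: computable_pden].
apply: computable_and; first exact: computable_eq.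
apply: computable_and; first by apply/computable_neg/computable_eq.
apply: computable_and.
  by apply: computable_eq => //; do 2!apply: computable_pair => //.
apply: computable_and; first by apply: computable_eq => //; exact: f1 (f1 C2c).
apply: computable_and; first by apply: computable_eq => //; exact: f1 (f1 C3c).
apply: computable_and; first by apply: computable_rat_lt0; exact: f2 (f1 C3c).
have ldc := computable_low_den a_c bc xc.
have lnc := computable_low_num a_c bc xc.
apply: computable_leq; apply: computable_mul.
- exact: computable_pnum.
- exact: computable_mul.
- by apply: computable_add => //; exact: computable_mul.
- exact: computable_pden.
Qed.

End computable_checks.

(** * Rational bounds as real inequalities *)

Section real_bounds.
Variable R : realType.
Implicit Types (a b p : R) (y : seq bool).

Definition bernoulli_mass p y : R :=
  p ^+ count id y * (1 - p) ^+ count negb y.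

(** Clamping keeps the factors nonnegative when [a] or [b] leaves [[0, 1]]. In the factor for zeros,
    the inner maximum comes from [pnum] and the outer one from the truncated subtraction in
    [low_num]. *)
Definition low_bound a b y : R :=
  Num.max 0 a ^+ count id y * Num.max 0 (1 - Num.max 0 b) ^+ count negb y.

Definition high_bound a b y : R :=
  Num.min (Num.max 0 b) 1 ^+ count id y *
  Num.max 0 (1 - Num.max 0 a) ^+ count negb y.

Lemma bernoulli_cylinder (p : {i01 R}) y :
  bernoulli p (cylinder y) = (bernoulli_mass p%:num y)%:E.
Proof.
rewrite bernoulliE /bernoulli_mass; congr EFin.
elim: y => [|c y ih]; first by rewrite big_nil !expr0 mulr1.
rewrite big_cons ih /=; case: c; rewrite /= ?add0n ?add1n !exprS.
  by rewrite mulrA.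
by rewrite mulrCA.
Qed.

Lemma sub_expr_le (x z d : R) n : 0 <= x -> x <= z -> z <= 1 -> z - x <= d ->
  z ^+ n - x ^+ n <= n%:R * d.
Proof.
move=> x0 xz z1 zxd; have d0 : 0 <= d by lra.
elim: n => [|n ih]; first by rewrite !expr0 subrr mul0r.
rewrite !exprS -natr1 mulrDl mul1r.
have zn0 : 0 <= x ^+ n by rewrite exprn_ge0.
have zn1 : x ^+ n <= 1 by rewrite exprn_ile1//; lra.
have xzn : x ^+ n <= z ^+ n by rewrite lerXn2r ?nnegrE//; lra.
have -> : z * z ^+ n - x * x ^+ n =
    z * (z ^+ n - x ^+ n) + (z - x) * x ^+ n by ring.
have : 0 <= z by lra.
by move: (z ^+ n) (x ^+ n) (n%:R * d) zn0 zn1 xzn ih => /= ? ? ? ? ? ? ? ?; nra.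
Qed.

(** One power is changed at a time while the other stays at most [1]. With [k] ones and [l] zeros,
    [k + l] is the length of the word; this is the rate at which the bounds approach [B_p(y)]. *)
Lemma sub_exprM_le (x z x' z' d : R) k l :
  0 <= x -> x <= z -> z <= 1 -> z - x <= d ->
  0 <= x' -> x' <= z' -> z' <= 1 -> z' - x' <= d ->
  z ^+ k * z' ^+ l - x ^+ k * x' ^+ l <= (k + l)%:R * d.
Proof.
move=> x0 xz z1 zxd x'0 xz' z1' zxd'.
have k1 := sub_expr_le k x0 xz z1 zxd.
have l1 := sub_expr_le l x'0 xz' z1' zxd'.
have -> : z ^+ k * z' ^+ l - x ^+ k * x' ^+ l =
  (z ^+ k - x ^+ k) * z' ^+ l + x ^+ k * (z' ^+ l - x' ^+ l) by ring.
have zl0 : 0 <= z' ^+ l by rewrite exprn_ge0//; lra.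
have zl1 : z' ^+ l <= 1 by rewrite exprn_ile1//; lra.
have xk0 : 0 <= x ^+ k by rewrite exprn_ge0//; lra.
have xk1 : x ^+ k <= 1 by rewrite exprn_ile1//; lra.
have xzk : x ^+ k <= z ^+ k by rewrite lerXn2r ?nnegrE//; lra.
have xzl : x' ^+ l <= z' ^+ l by rewrite lerXn2r ?nnegrE//; lra.
rewrite natrD [leRHS]mulrDl; apply: lerD.
  by apply: le_trans k1; rewrite ler_piMr// subr_ge0.
by apply: le_trans l1; rewrite ler_piMl// subr_ge0.
Qed.

Lemma max0_ge0 a : 0 <= Num.max 0 a. Proof. by rewrite le_max lexx. Qed.

Let low_factors a b p : 0 <= p -> p <= 1 -> a < p -> p < b -> 
  [/\ Num.max 0 a <= p, p - (b - a) <= Num.max 0 a,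
  Num.max 0 (1 - Num.max 0 b) <= 1 - p &
  1 - p - (b - a) <= Num.max 0 (1 - Num.max 0 b)].
Proof.
move=> p0 p1 ap pb; case: (leP 0 (1 - Num.max 0 b)); case: (leP 0 a) => ?;
  by case: (leP 0 b) => ? ?; split; lra.
Qed.

Let high_factors a b p : 0 <= p -> p <= 1 -> a < p -> p < b -> 
  [/\ p <= Num.min (Num.max 0 b) 1,
  Num.min (Num.max 0 b) 1 <= p + (b - a),
  1 - p <= Num.max 0 (1 - Num.max 0 a) &
  Num.max 0 (1 - Num.max 0 a) <= 1 - p + (b - a)].
Proof.
move=> p0 p1 ap pb.
case: (leP 0 (1 - Num.max 0 a)); case: (leP (Num.max 0 b) 1);
  by case: (leP 0 a) => ?; case: (leP 0 b) => ? ? ?; split; lra.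
Qed.

Let high_le1 a b :
  Num.min (Num.max 0 b) 1 <= 1 /\ Num.max 0 (1 - Num.max 0 a) <= 1.
Proof.
case: (leP 0 (1 - Num.max 0 a)); case: (leP (Num.max 0 b) 1);
  by case: (leP 0 a) => ?; case: (leP 0 b) => ? ? ?; split; lra.
Qed.

(** This and [high_bound_ge] make accepted checks sound; [low_bound_near] and [high_bound_near] show
    conversely that narrow enough brackets are accepted. *)
Lemma low_bound_le a b p y : 0 <= p -> p <= 1 -> a < p -> p < b -> 
  low_bound a b y <= bernoulli_mass p y.
Proof.
move=> p0 p1 ap pb; case: (low_factors p0 p1 ap pb) => f1 f2 f3 f4.
apply: ler_pM;
  by rewrite ?exprn_ge0 ?max0_ge0// lerXn2r ?nnegrE ?max0_ge0//; lra.
Qed.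

Lemma high_bound_ge a b p y : 0 <= p -> p <= 1 -> a < p -> p < b -> 
  bernoulli_mass p y <= high_bound a b y.
Proof.
move=> p0 p1 ap pb; case: (high_factors p0 p1 ap pb) => f1 f2 f3 f4.
apply: ler_pM;
  by rewrite ?exprn_ge0// ?lerXn2r ?nnegrE ?max0_ge0//; lra.
Qed.

Lemma low_bound_near a b p y : 0 <= p -> p <= 1 -> a < p -> p < b -> 
  bernoulli_mass p y - (size y)%:R * (b - a) <= low_bound a b y.
Proof.
move=> p0 p1 ap pb; case: (low_factors p0 p1 ap pb) => f1 f2 f3 f4.
rewrite lerBlDr -lerBlDl -(count_predC id y).
by apply: sub_exprM_le => //; rewrite ?max0_ge0//; lra.
Qed.

Lemma high_bound_near a b p y : 0 <= p -> p <= 1 -> a < p -> p < b -> 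
  high_bound a b y <= bernoulli_mass p y + (size y)%:R * (b - a).
Proof.
move=> p0 p1 ap pb; case: (high_factors p0 p1 ap pb) => f1 f2 f3 f4.
(* The larger arguments of [sub_exprM_le] must be at most [1], whence the clamping at [1] in
   [high_bound]. *)
case: (high_le1 a b) => b1 b2.
rewrite -lerBlDl -(count_predC id y).
by apply: sub_exprM_le => //; lra.
Qed.

Lemma low_bound_ge0 a b y : 0 <= low_bound a b y.
Proof. by rewrite mulr_ge0// exprn_ge0// max0_ge0. Qed.

Lemma pden_gt0 (r : rat) : (0 < pden r)%N.
Proof. by rewrite /pden absz_gt0 denq_neq0. Qed.

Lemma pfrac (r : rat) : (pnum r)%:R / (pden r)%:R = Num.max 0 (ratr r) :> R.
Proof.
have d0 := denq_gt0 r; rewrite /pden /pnum.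
have -> : (`|denq r|%N)%:R = (denq r)%:~R :> R.
  by rewrite -[in RHS](gtz0_abs d0).
case E: (numq r) => [n|n].
  have r0 : 0 <= r by rewrite -numq_ge0 E.
  by rewrite max_r ?ler0q// /ratr E.
have r0 : r < 0 by rewrite -numq_lt0 E.
by rewrite mul0r max_l// lerq0 ltW.
Qed.

Lemma ltr_natfrac (m n m' n' : nat) : (0 < n)%N -> (0 < n')%N ->
  (m%:R / n%:R < m'%:R / n'%:R :> R) = (m * n' < m' * n)%N.
Proof.
move=> n0 n'0; rewrite ltr_pdivrMr ?ltr0n// mulrAC ltr_pdivlMr ?ltr0n//.
by rewrite -!natrM ltr_nat.
Qed.

Lemma ler_natfrac (m n m' n' : nat) : (0 < n)%N -> (0 < n')%N ->
  (m%:R / n%:R <= m'%:R / n'%:R :> R) = (m * n' <= m' * n)%N.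
Proof.
move=> n0 n'0; rewrite ler_pdivrMr ?ltr0n// mulrAC ler_pdivlMr ?ltr0n//.
by rewrite -!natrM ler_nat.
Qed.

Lemma pfrac_compl (r : rat) :
  (pden r - pnum r)%:R / (pden r)%:R = Num.max 0 (1 - Num.max 0 (ratr r)) :> R.
Proof.
have d0 : 0 < (pden r)%:R :> R by rewrite ltr0n pden_gt0.
rewrite -pfrac; have [le|lt] := leqP (pnum r) (pden r).
  rewrite natrB// mulrBl divff ?gt_eqF// max_r// subr_ge0.
  by rewrite ler_pdivrMr// mul1r ler_nat.
have -> : (pden r - pnum r = 0)%N by lia.
by rewrite mul0r max_l// subr_le0 ler_pdivlMr// mul1r ler_nat ltnW.
Qed.

Lemma low_bound_frac (a b : rat) y : (low_num a b y)%:R / (low_den a b y)%:R =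
  low_bound (ratr a) (ratr b) y.
Proof.
rewrite /low_bound -pfrac -pfrac_compl /low_num /low_den !natrM !natrX.
by rewrite invfM mulrACA -!expr_div_n.
Qed.

Lemma high_bound_frac (a b : rat) y :
  (high_num a b y)%:R / (high_den a b y)%:R = high_bound (ratr a) (ratr b) y.
Proof.
rewrite /high_bound -pfrac -pfrac_compl /high_num /high_den !natrM !natrX.
rewrite invfM mulrACA -!expr_div_n; congr (_ ^+ _ * _).
have d0 : 0 < (pden b)%:R :> R by rewrite ltr0n pden_gt0.
have [le|/ltnW le] := leqP (pnum b) (pden b).
  by rewrite min_l// ler_pdivrMr// mul1r ler_nat.
by rewrite min_r ?divff ?gt_eqF// ler_pdivlMr// mul1r ler_nat.
Qed.

Lemma low_den_gt0 (a b : rat) y : (0 < low_den a b y)%N.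
Proof. by rewrite muln_gt0 !expn_gt0 !pden_gt0. Qed.

Lemma high_den_gt0 (a b : rat) y : (0 < high_den a b y)%N.
Proof. by rewrite muln_gt0 !expn_gt0 !pden_gt0. Qed.

Lemma bounds_checkP (y : seq bool) (u v a b : rat) :
  reflect (ratr u < low_bound (ratr a) (ratr b) y /\
           high_bound (ratr a) (ratr b) y < (ratr v : R))
    (bounds_check (y, u, v) (a, b)).
Proof.
have hb : (high_num a b y * pden v < pnum v * high_den a b y)%N =
    (high_bound (ratr a) (ratr b) y < (ratr v : R)).
  rewrite -(ltr_natfrac _ _ (high_den_gt0 a b y) (pden_gt0 v)) high_bound_frac.
  rewrite pfrac lt_max ltNge mulr_ge0// exprn_ge0 ?max0_ge0//.
  by rewrite le_min ler01 max0_ge0.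
have lb : (u < 0) || (pnum u * low_den a b y < low_num a b y * pden u)%N =
    (ratr u < low_bound (ratr a) (ratr b) y :> R).
  rewrite -(ltr_natfrac _ _ (pden_gt0 u) (low_den_gt0 a b y)) low_bound_frac.
  rewrite pfrac; case: (ltP u 0) => /= u0.
    by apply/esym; apply: lt_le_trans (low_bound_ge0 _ _ _); rewrite ltrq0.
  by rewrite max_r// ler0q.
by apply: (iffP andP); rewrite lb hb.
Qed.

End real_bounds.

(** * Restriction of a uniform test to the Bernoulli measures *)

Lemma count_neg_eq0 (T : Type) (P : pred T) (s : seq T) :
  (count (fun x => ~~ P x) s == 0%N) = all P s.
Proof.
by rewrite eqn0Ngt -has_count -all_predC; apply: eq_all => x /=; rewrite negbK.
Qed.

Section restriction.
Variable R : realType.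

(** Each condition is strict, hence holds with a positive margin, and the bounds err by at most
    [size y] times [b - a]; finitely many thresholds have a positive minimum. *)
Lemma bounds_near (p : R) (cs : seq (seq bool * rat * rat)) :
  0 <= p -> p <= 1 ->
  (forall y (u v : rat), (y, u, v) \in cs ->
    ratr u < bernoulli_mass p y < ratr v) ->
  exists2 d : R, 0 < d & forall a b : rat,
    ratr a < p -> p < ratr b -> ratr b - ratr a < d ->
    all (fun c => bounds_check c (a, b)) cs.
Proof.
move=> p0 p1; elim: cs => [|[[y u] v] cs ih] h; first by exists 1.
have [|d d0 dP] := ih.
  by move=> y' u' v' cs'; apply: h; rewrite inE cs' orbT.
have /andP[uy yv] : ratr u < bernoulli_mass p y < ratr v.
  by apply: h; rewrite mem_head.
set B := bernoulli_mass p y in uy yv.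
have s0 : 0 < (size y).+1%:R :> R by rewrite ltr0n.
(* The successor keeps the divisor positive for the empty word. *)
pose d' := Num.min (B - ratr u) (ratr v - B) / (size y).+1%:R.
have d'0 : 0 < d' by rewrite divr_gt0// lt_min !subr_gt0 uy yv.
exists (Num.min d d'); first by rewrite lt_min d0 d'0.
move=> a b ap pb; rewrite lt_min => /andP[abd]; rewrite ltr_pdivlMr//.
rewrite lt_min => /andP[abu abv] /=; rewrite dP// andbT.
have sab : (size y)%:R * (ratr b - ratr a) <=
    (ratr b - ratr a) * (size y).+1%:R :> R.
  rewrite mulrC ler_wpM2l ?ler_nat//; lra.
apply/(bounds_checkP R); split.
  by have := low_bound_near y p0 p1 ap pb; rewrite -/B; lra.
by have := high_bound_near y p0 p1 ap pb; rewrite -/B; lra.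
Qed.

Lemma bounds_exist (p : R) (cs : seq (seq bool * rat * rat)) :
  0 <= p -> p <= 1 ->
  (forall y (u v : rat), (y, u, v) \in cs ->
    ratr u < bernoulli_mass p y < ratr v) ->
  exists a b : rat, [/\ ratr a < p, p < ratr b &
    all (fun c => bounds_check c (a, b)) cs].
Proof.
move=> p0 p1 /(bounds_near p0 p1)[d d0 dP].
have [|a] := @rat_in_itvoo R (p - d / 2) p; first by lra.
rewrite in_itv /= => /andP[a1 a2].
have [|b] := @rat_in_itvoo R p (p + d / 2); first by lra.
rewrite in_itv /= => /andP[b1 b2].
by exists a, b; split=> //; apply: dP => //; lra.
Qed.

(** The inverse image of a basic set under [p |-> B_p] is exhausted by the rational intervals on
    which [bounds_check] accepts all conditions; completeness and soundness of the check are the two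
    inclusions. *)
Lemma restriction_lower_semicomputable
    (t : Omega * probability Omega R -> \bar R) :
  lower_semicomputable (@measure_basic R) t ->
  lower_semicomputable (@bernoulli_basic R)
    (fun wp => t (wp.1, bernoulli wp.2)).
Proof.
move=> [E Een tE].
exists (fun r b => exists2 e, E e.1 e.2 & restriction_check (e, (r, b))).
  have := enumerable_image _ Een computable_restriction_check.
  have -> : [set rb : rat * _ | exists2 e, E e.1 e.2 &
      restriction_check (e, (rb.1, rb.2))] =
    [set a | exists2 e, [set rb : rat * _ | E rb.1 rb.2] e &
      restriction_check (e, a)].
    by apply/seteqP; split=> -[r b].
  apply; apply: is_code_pair is_code_rat _.
  apply: is_code_pair (is_code_seq is_code_bool) _; apply: is_code_seq.
  apply: is_code_pair is_code_rat; apply: is_code_pair is_code_rat.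
  exact: is_code_seq is_code_bool.
move=> r; apply/seteqP; split=> [[w p]|[w p] [[[x a] b] [[r' [x' cs]] Ee]]] /=.
  move=> rt; have : [set wP | ((ratr r)%:E < t wP)%E] (w, bernoulli p) by [].
  rewrite tE => -[[x cs] Er [wx pcs]].
  have [|||a [b [ap pb abP]]] := @bounds_exist p%:num cs => //.
    move=> y u v ycs; have := pcs _ _ _ ycs.
    by rewrite /= bernoulli_cylinder !lte_fin.
  exists (x, a, b); last by split=> //; rewrite ap pb.
  by exists (r, (x, cs)) => //=; rewrite !eqxx count_neg_eq0.
move=> /and3P[/eqP rE /eqP xE]; rewrite count_neg_eq0 => /allP cP.
move=> [wx /andP[ap pb]].
suff : [set wP | ((ratr r)%:E < t wP)%E] (w, bernoulli p) by [].
rewrite tE; exists (x, cs); first by rewrite rE xE.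
split=> // y u v /cP /(bounds_checkP R)[ul hv].
rewrite bernoulli_cylinder !lte_fin.
rewrite (lt_le_trans ul)/=; last exact: low_bound_le.
by apply: le_lt_trans hv; exact: high_bound_ge.
Qed.

Lemma restriction_test (t : Omega * probability Omega R -> \bar R) :
  uniform_test t ->
  uniform_bernoulli_test (fun wp => t (wp.1, bernoulli wp.2)).
Proof.
move=> [tl t0 ti]; split=> [|wp|p]; [|exact: t0|exact: ti].
exact: restriction_lower_semicomputable.
Qed.

End restriction.

(** * Maxima of multiples of cylinder indicators *)

Section cylinder_max.
Variables (R : realType) (T : eqType) (h : T -> R) (x : T -> seq bool).

Definition cylinder_max (s : seq T) (w : Omega) : R :=
  \big[Num.max/0]_(e <- s) (h e * \1_(cylinder (x e) : set Omega) w).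

Lemma cylinder_max_cons e s w : cylinder_max (e :: s) w =
  Num.max (h e * \1_(cylinder (x e) : set Omega) w) (cylinder_max s w).
Proof. exact: big_cons. Qed.

Lemma cylinder_max_ge0 s w : 0 <= cylinder_max s w.
Proof. exact: bigmax_ge_id. Qed.

Lemma cylinder_indicT (y : seq bool) (w : Omega) : cylinder y w ->
  \1_(cylinder y : set Omega) w = 1 :> R.
Proof. by move=> wy; rewrite indicE mem_set. Qed.

Lemma cylinder_indicF (y : seq bool) (w : Omega) : ~ cylinder y w ->
  \1_(cylinder y : set Omega) w = 0 :> R.
Proof. by move=> wy; rewrite indicE memNset. Qed.

Lemma cylinder_max_le s w M : 0 <= M ->
  (forall e, e \in s -> cylinder (x e) w -> h e <= M) -> cylinder_max s w <= M.
Proof.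
move=> M0 hM; rewrite /cylinder_max big_seq; apply: bigmax_le => // e es.
have [wx|wx] := pselect (cylinder (x e) w).
  by rewrite cylinder_indicT// mulr1 hM.
by rewrite cylinder_indicF// mulr0.
Qed.

Lemma cylinder_max_ge s w e : e \in s -> cylinder (x e) w ->
  h e <= cylinder_max s w.
Proof.
move=> es wx; rewrite /cylinder_max.
apply: (Order.TotalTheory.bigmax_sup_seq _ e) => //.
by rewrite cylinder_indicT// mulr1.
Qed.

Lemma cylinder_indic_const (y z : seq bool) (w w' : Omega) :
  (size y <= size z)%N -> cylinder z w -> cylinder z w' ->
  \1_(cylinder y : set Omega) w = \1_(cylinder y : set Omega) w' :> R.
Proof.
move=> yz wz wz'; rewrite !indicE; congr (_%:R); congr nat_of_bool.
by apply/idP/idP => /set_mem wy; apply/mem_set => i iy;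
  rewrite -(wy _ iy) wz ?wz'// (leq_trans iy).
Qed.

(* [e] comes with a longest word, so the maximum over the other items is
   constant on its cylinder. *)
Lemma cylinder_max_split e s : 0 <= h e ->
  (forall e', e' \in s -> (size (x e') <= size (x e))%N) ->
  exists2 d : R, 0 <= d <= h e & forall w, cylinder_max (e :: s) w =
    cylinder_max s w + d * \1_(cylinder (x e) : set Omega) w.
Proof.
(* The word padded with [false] is a point of its own cylinder, at which the constant value [m] is
   read off. *)
move=> he sz; pose w0 : Omega := nth false (x e).
pose m := cylinder_max s w0.
have m0 : 0 <= m by exact: cylinder_max_ge0.
exists (Num.max (h e) m - m) => [|w].
  by case: (leP (h e) m) => ?; apply/andP; split; lra.
rewrite cylinder_max_cons; have [wx|wx] := pselect (cylinder (x e) w).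
  have -> : cylinder_max s w = m.
    apply: eq_big_seq => e' /sz e's; congr *%R.
    exact: cylinder_indic_const e's _ _.
  by rewrite cylinder_indicT// !mulr1 addrC subrK.
by rewrite cylinder_indicF// !mulr0 addr0 max_r// cylinder_max_ge0.
Qed.

Lemma measurable_cylinder_indic (y : seq bool) :
  measurable_fun [set: Omega] (\1_(cylinder y : set Omega) : Omega -> R).
Proof. by apply: measurable_indic; exact: measurable_cylinder. Qed.

Lemma measurable_cylinder_max s : measurable_fun [set: Omega] (cylinder_max s).
Proof.
elim: s => [|e s ih].
  rewrite (_ : cylinder_max [::] = cst 0); first exact: measurable_cst.
  by apply/funext => w; rewrite /cylinder_max big_nil.
rewrite (_ : cylinder_max (e :: s) =
  (fun w => h e * \1_(cylinder (x e) : set Omega) w) \max cylinder_max s).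
  apply: measurable_maxr => //; apply: measurable_funM => //.
  exact: measurable_cylinder_indic.
by apply/funext => w; rewrite cylinder_max_cons.
Qed.

Lemma integral_cylinder_max_add (P : probability Omega R) e s d : 0 <= d ->
  (forall w, cylinder_max (e :: s) w =
    cylinder_max s w + d * \1_(cylinder (x e) : set Omega) w) ->
  (\int[P]_w (cylinder_max (e :: s) w)%:E =
   \int[P]_w (cylinder_max s w)%:E + d%:E * P (cylinder (x e)))%E.
Proof.
move=> d0 dE; under eq_integral do rewrite dE EFinD EFinM.
have mi : measurable_fun [set: Omega]
    (fun w => (\1_(cylinder (x e) : set Omega) w : R)%:E).
  by apply/measurable_EFinP; exact: measurable_cylinder_indic.
have mm : measurable_fun [set: Omega] (fun w => (cylinder_max s w)%:E).
  by apply/measurable_EFinP; exact: measurable_cylinder_max.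
have i0 w : (0 <= (\1_(cylinder (x e) : set Omega) w : R)%:E)%E.
  by rewrite lee_fin indicE ler0n.
rewrite ge0_integralD//=; last first.
- exact: measurable_funeM.
- by move=> w _; rewrite mule_ge0.
- by move=> w _; rewrite lee_fin cylinder_max_ge0.
rewrite ge0_integralZl_EFin// integral_indic ?setIT//.
exact: measurable_cylinder.
Qed.

(* The maximum is a combination of the indicators with coefficients between
   [0] and [h], whence the comparison of the integrals. *)
Lemma integral_cylinder_max_le (P Q : probability Omega R) (eps : T -> R) s :
  (forall e, e \in s -> [/\ 0 <= h e, 0 <= eps e &
    (P (cylinder (x e)) <= Q (cylinder (x e)) + (eps e)%:E)%E]) ->
  (\int[P]_w (cylinder_max s w)%:E <=
   \int[Q]_w (cylinder_max s w)%:E + (\sum_(e <- s) h e * eps e)%:E)%E.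
Proof.
pose longer e e' := (size (x e') <= size (x e))%N.
have perm t : perm_eq t s -> cylinder_max s = cylinder_max t.
  by move=> ts; apply/funext => w; exact/esym/perm_big.
(* Longest words come first, so that [cylinder_max_split] applies to the head at each step of the
   induction. *)
wlog : s perm / sorted longer s => [H hs|].
  have ts : perm_eq (sort longer s) s by rewrite perm_sort.
  rewrite (perm _ ts) -(perm_big _ ts) /=; apply: H.
  - by move=> t tp; apply/funext => w; exact/esym/perm_big.
  - by apply: sort_sorted => e e'; exact: leq_total.
  - by move=> e; rewrite (perm_mem ts); exact: hs.
move=> {perm}; elim: s => [|e s ih] so hs.
  rewrite big_nil adde0; have -> : cylinder_max [::] = cst 0.
    by apply/funext => w; rewrite /cylinder_max big_nil.
  by rewrite /= !integral0.
have tr : transitive longer by move=> a b c ab bc; exact: leq_trans bc ab.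
have /= := so; rewrite path_sortedE// => /andP[/allP sz so'].
have [he epse Pe] := hs e (mem_head _ _).
have [d /andP[d0 dh] dE] := cylinder_max_split he sz.
rewrite !(integral_cylinder_max_add _ d0 dE) big_cons EFinD.
have {}ih := ih so' (fun e' e's => hs e' (@mem_behead _ (e :: s) _ e's)).
have Qfin : (Q (cylinder (x e)) \is a fin_num).
  by apply: fin_num_measure; exact: measurable_cylinder.
apply: (@le_trans _ _ ((\int[Q]_w (cylinder_max s w)%:E +
    (\sum_(j <- s) h j * eps j)%:E) +
    (d%:E * Q (cylinder (x e)) + (h e * eps e)%:E))%E).
  apply: leeD => //; apply: (@le_trans _ _ (d%:E *
    (Q (cylinder (x e)) + (eps e)%:E))%E); first by rewrite lee_wpmul2l.
  rewrite muleDr ?fin_num_adde_defl//.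
  apply: leeD2l.
  by rewrite -EFinM lee_fin ler_wpM2r.
by rewrite addeACA [X in (_ + X <= _)%E]addeC.
Qed.

End cylinder_max.

(** The integral of a nonnegative function is a supremum over the simple functions below it, which
    is monotone for arbitrary functions; this is applied to a test known only through its level
    sets. *)
Lemma ge0_le_integral_pointwise d (T : measurableType d) (R : realType)
    (mu : {measure set T -> \bar R}) (f g : T -> \bar R) :
  (forall x, 0 <= f x)%E -> (forall x, f x <= g x)%E ->
  (\int[mu]_x f x <= \int[mu]_x g x)%E.
Proof.
move=> f0 fg; have g0 x : (0 <= g x)%E by exact: le_trans (f0 x) (fg x).
rewrite !ge0_integralTE//; apply: ereal_sup_le => _ [h hf <-].
by exists h => // x; exact: le_trans (hf x) (fg x).
Qed.

(** * Finite stages of coded items and geometric weights *)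

Section code_sum.
Variables (R : realType) (T : countType) (good : pred T).

Definition items_below (n : nat) : seq T :=
  [seq e <- pmap pickle_inv (iota 0 n) | good e].

Lemma mem_items_below n e :
  (e \in items_below n) = good e && (pickle e < n)%N.
Proof.
rewrite mem_filter (can2_mem_pmap (@pickle_invK T) (@pickleK_inv T)).
by rewrite mem_iota.
Qed.

(** Distinct items have distinct codes, so the sum is bounded by a part of the geometric sum of
    [2^-k] over [k < n], which equals [2 - 2 * 2^-n]. *)
Lemma sum_items_below (F : T -> R) n :
  (forall e, good e -> F e <= 2^-1 ^+ pickle e) ->
  \sum_(e <- items_below n) F e <= 2 - 2 * 2^-1 ^+ n.
Proof.
move=> FP; elim: n => [|n ih]; first by rewrite big_nil expr0; lra.
rewrite /items_below -addn1 iotaD pmap_cat filter_cat big_cat /= add0n.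
rewrite addn1 exprS.
have : \sum_(e <- [seq e <- oapp (cons^~ [::]) [::] (pickle_inv n : option T) |
    good e]) F e <= 2^-1 ^+ n.
  case E: (pickle_inv n) => [e|] /=; last by rewrite big_nil exprn_ge0.
  have en : pickle e = n.
    by have := @pickle_invK T n; rewrite /ocancel E.
  case: ifPn => [/FP|_]; first by rewrite big_seq1 en.
  by rewrite big_nil exprn_ge0.
by move: ih; rewrite /items_below; move: (2^-1 ^+ n) => ?; lra.
Qed.

End code_sum.

Lemma pnum_gt0 (q : rat) : (0 < pnum q)%N = (0 < q).
Proof. by rewrite -numq_gt0 /pnum; case: (numq q). Qed.

(** * Extension of a Bernoulli test to all measures *)

Section extension.
Variables (R : realType) (E : rat -> set (seq bool * rat * rat)).
Local Notation item := (rat * (seq bool * rat * rat))%type.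
Implicit Types (P : probability Omega R) (e : item).

Definition item_word e : seq bool := e.2.1.1.
Definition item_height e : R := ratr e.1 / 4.
Definition tolerance e : R := (tolerance_den e)%:R^-1.

Lemma low_bound_add_tolerance (a b : rat) y e : (0 < tolerance_den e)%N ->
  low_bound (ratr a) (ratr b) y + tolerance e =
  (low_num a b y * tolerance_den e + low_den a b y)%:R /
  (low_den a b y * tolerance_den e)%:R.
Proof.
move=> W0; rewrite -low_bound_frac /tolerance -[X in _ + X]mul1r addf_div.
- by rewrite mul1r -!natrM -natrD.
- by rewrite pnatr_eq0 -lt0n low_den_gt0.
- by rewrite pnatr_eq0 -lt0n.
Qed.

Definition mass P (y : seq bool) : R := fine (P (cylinder y)).

Lemma massE P y : P (cylinder y) = (mass P y)%:E.
Proof.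
by rewrite fineK//; apply: fin_num_measure; exact: measurable_cylinder.
Qed.

Lemma mass_ge0 P y : 0 <= mass P y.
Proof. exact: fine_ge0. Qed.

Lemma mass_le1 P y : mass P y <= 1.
Proof.
by rewrite -lee_fin -massE; apply: probability_le1; exact: measurable_cylinder.
Qed.

Definition parameter P : {i01 R} :=
  Itv01 (mass_ge0 P [:: true]) (mass_le1 P [:: true]).

Lemma mass_bernoulli (p : {i01 R}) y :
  mass (bernoulli p) y = bernoulli_mass p%:num y.
Proof. by rewrite /mass bernoulli_cylinder. Qed.

Lemma parameter_bernoulli (p : {i01 R}) : parameter (bernoulli p) = p.
Proof.
apply: val_inj => /=; rewrite mass_bernoulli /bernoulli_mass /=.
by rewrite expr1 expr0 mulr1.
Qed.

(** The conditions on [P] are strict inequalities between continuous functions of finitely many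
    [P(y)], so an active item is always witnessed by a basic open set of measures. *)
Definition active P e : Prop := [/\ E e.1 e.2, 0 < e.1,
  ratr e.2.1.2 < (parameter P)%:num < ratr e.2.2 &
  mass P (item_word e) <
    bernoulli_mass (parameter P)%:num (item_word e) + tolerance e].

Definition active_items P := items_below (fun e => `[< active P e >]).

(** The supremum is taken along increasing finite stages, to be integrated by monotone
    convergence. *)
Definition extension (wP : Omega * probability Omega R) : \bar R :=
  ereal_sup (range (fun n =>
    (cylinder_max item_height item_word (active_items wP.2 n) wP.1)%:E)).

Lemma mem_active_items P n e :
  reflect (active P e /\ (pickle e < n)%N) (e \in active_items P n).
Proof. by rewrite mem_items_below; apply: (iffP andP) => -[/asboolP]. Qed.

Lemma item_height_le_extension w P e :
  active P e -> cylinder (item_word e) w ->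
  ((item_height e)%:E <= extension (w, P))%E.
Proof.
move=> aPe we; apply: (@le_trans _ _ (cylinder_max item_height item_word
  (active_items P (pickle e).+1) w)%:E).
  by rewrite lee_fin; apply: cylinder_max_ge => //; apply/mem_active_items.
by apply: ereal_sup_ubound; exists (pickle e).+1.
Qed.

Lemma extension_ge0 wP : (0 <= extension wP)%E.
Proof.
apply: le_trans (ereal_sup_ubound _); last by exists 0%N.
by rewrite lee_fin cylinder_max_ge0.
Qed.

Lemma extension_gt w P (r : R) : 0 <= r -> (r%:E < extension (w, P))%E ->
  exists e, [/\ active P e, cylinder (item_word e) w & r < item_height e].
Proof.
move=> r0 /ereal_sup_gt[_ [n _ <-]]; rewrite lte_fin => rn.
apply: contrapT => ne; move: rn; rewrite ltNge => /negP; apply.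
apply: cylinder_max_le => // e /mem_active_items[ae _] we.
by rewrite leNgt; apply/negP => re; apply: ne; exists e.
Qed.

Lemma item_height_tolerance e : 0 < e.1 ->
  item_height e * tolerance e <= 2^-1 ^+ pickle e / 4.
Proof.
move=> e0; rewrite /item_height /tolerance /tolerance_den mulrAC ler_pM2r//.
have n0 : (0 < pnum e.1)%N by rewrite pnum_gt0.
rewrite natrM natrX invfM mulrA exprVn ler_piMl ?invr_ge0 ?exprn_ge0//.
rewrite ler_pdivrMr ?ltr0n// mul1r.
have -> : ratr e.1 = (pnum e.1)%:R / (pden e.1)%:R :> R.
  by rewrite pfrac max_r// ler0q ltW.
by rewrite ler_pdivrMr ?ltr0n ?pden_gt0// ler_peMr// ler1n pden_gt0.
Qed.

Lemma tolerance_ge0 e : 0 <= tolerance e.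
Proof. by rewrite invr_ge0. Qed.

Lemma tolerance_gt0 e : 0 < e.1 -> 0 < tolerance e.
Proof.
by move=> e0; rewrite invr_gt0 ltr0n muln_gt0 expn_gt0 andbT pnum_gt0.
Qed.

Section test.
Variable t : Omega * {i01 R} -> \bar R.
Hypotheses (t_ge0 : forall wp, (0 <= t wp)%E)
  (t_int : forall p : {i01 R}, (\int[bernoulli p]_w t (w, p) <= 1)%E)
  (tE : forall r, [set wp | ((ratr r)%:E < t wp)%E] =
    \bigcup_(b in E r) bernoulli_basic b).

Let active_max P n w : R :=
  cylinder_max item_height item_word (active_items P n) w.

Lemma active_lt P e w : active P e -> cylinder (item_word e) w ->
  ((ratr e.1)%:E < t (w, parameter P))%E.
Proof.
move=> [Ee _ pe _] we.
suff : [set wp | ((ratr e.1)%:E < t wp)%E] (w, parameter P) by [].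
by rewrite tE; exists e.2 => //; case: e Ee pe we => r [[x u] v].
Qed.

(** Four times the maximum stays below [t] at the parameter [P(1)]: each active item [(r, x, u, v)]
    certifies [t > r] there on the cylinder of [x]. *)
Lemma integral_active_bernoulli P n :
  (\int[bernoulli (parameter P)]_w (active_max P n w)%:E <= 4^-1%:E)%E.
Proof.
have h : (\int[bernoulli (parameter P)]_w
    (4%:E * (active_max P n w)%:E) <= 1)%E.
  apply: le_trans (t_int (parameter P)).
  apply: ge0_le_integral_pointwise => w.
    by rewrite -EFinM lee_fin mulr_ge0// cylinder_max_ge0.
  have := t_ge0 (w, parameter P); case E0: (t _) => [m| |]; rewrite ?leey//.
  rewrite -EFinM !lee_fin => m0; rewrite mulrC -ler_pdivlMr//.
  apply: cylinder_max_le; first by rewrite divr_ge0.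
  move=> e /mem_active_items[ae _] we; rewrite ler_pM2r//.
  by have := active_lt ae we; rewrite E0 lte_fin => /ltW.
move: h; rewrite ge0_integralZl_EFin//.
- by rewrite muleC -lee_pdivlMr// mul1e.
- by move=> w _; rewrite lee_fin cylinder_max_ge0.
- by apply/measurable_EFinP; exact: measurable_cylinder_max.
Qed.

Lemma integral_active P n : (\int[P]_w (active_max P n w)%:E <= 1)%E.
Proof.
have := @integral_cylinder_max_le R _ item_height item_word P
  (bernoulli (parameter P)) tolerance (active_items P n).
move=> H; apply: (le_trans (H _)) => {H}.
  move=> e /mem_active_items[[_ e0 _ Pe] _]; split.
  - by rewrite divr_ge0// ler0q ltW.
  - exact: tolerance_ge0.
  - by rewrite massE bernoulli_cylinder -EFinD lee_fin ltW.
(* [4^-1] bounds the Bernoulli integral; the slacks contribute at most [2 / 4], as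
   [height * tolerance] is at most [2^-n / 4] for code [n]. *)
apply: (@le_trans _ _ (4^-1%:E + 2^-1%:E)%E); last first.
  by rewrite -EFinD lee_fin; lra.
apply: leeD; first exact: integral_active_bernoulli.
rewrite lee_fin.
have := @sum_items_below R _ (fun e => `[< active P e >])
  (fun e => item_height e * tolerance e * 4) n.
rewrite -mulr_suml => H.
have {}H : (\sum_(e <- active_items P n) item_height e * tolerance e) * 4 <=
    2 - 2 * 2^-1 ^+ n.
  by apply: H => e /asboolP[_ /item_height_tolerance + _ _]; lra.
have : 0 <= 2^-1 ^+ n :> R by rewrite exprn_ge0.
by move: (2^-1 ^+ n) H => ? H ?; lra.
Qed.

Lemma active_max_nondecreasing P w :
  {homo (fun n => (active_max P n w)%:E) : m n / (m <= n)%N >-> (m <= n)%E}.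
Proof.
move=> m n mn; rewrite lee_fin; apply: cylinder_max_le.
  exact: cylinder_max_ge0.
move=> e /mem_active_items[ae em] we; apply: cylinder_max_ge => //.
by apply/mem_active_items; split=> //; exact: leq_trans em mn.
Qed.

Lemma integral_extension P : (\int[P]_w extension (w, P) <= 1)%E.
Proof.
have mm n : measurable_fun [set: Omega] (fun w => (active_max P n w)%:E).
  by apply/measurable_EFinP; exact: measurable_cylinder_max.
have m0 n w : (0 <= (active_max P n w)%:E)%E.
  by rewrite lee_fin cylinder_max_ge0.
have -> : (\int[P]_w extension (w, P) =
    \int[P]_w limn (fun n => (active_max P n w)%:E))%E.
  apply: eq_integral => w _; apply/esym/cvg_lim => //.
  exact: ereal_nondecreasing_cvgn (@active_max_nondecreasing P w).
rewrite (@monotone_convergence _ _ _ P _ measurableT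
  (fun n w => (active_max P n w)%:E))//; last first.
  by move=> w _; exact: active_max_nondecreasing.
apply: lime_le; last by apply: nearW => n; exact: integral_active.
apply: ereal_nondecreasing_is_cvgn => m n mn.
by apply: ge0_le_integral_pointwise => // w; exact: active_max_nondecreasing.
Qed.

Lemma le_extension w p : (t (w, p) <= 4%:E * extension (w, bernoulli p))%E.
Proof.
have := extension_ge0 (w, bernoulli p).
case Em: (extension (w, bernoulli p)) => [m| |] //; last first.
  by move=> _; rewrite gt0_muley// leey.
rewrite lee_fin -EFinM => m0; rewrite leNgt; apply/negP => lt.
have [r mr rt] : exists2 r : rat, 4 * m < ratr r & ((ratr r)%:E < t (w, p))%E.
  move: lt; case: (t (w, p)) => [s| |] //.
    rewrite lte_fin => /rat_in_itvoo[r]; rewrite in_itv /= => /andP[? ?].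
    by exists r => //; rewrite lte_fin.
  have [|r] := @rat_in_itvoo R (4 * m) (4 * m + 1); first by lra.
  by rewrite in_itv /= => /andP[? ?] _; exists r => //; rewrite ltry.
(* [0 <= m] makes [r] positive, so the item found at level [r] may be active and has a positive
   tolerance. *)
have r0 : 0 < r by rewrite -(ltr0q R); lra.
have : [set wp | ((ratr r)%:E < t wp)%E] (w, p) by [].
rewrite tE => -[[[x u] v] Er [wx puv]].
have := @item_height_le_extension w (bernoulli p) (r, (x, u, v)).
rewrite Em lee_fin /item_height /= => H; have : ratr r / 4 <= m; last by lra.
apply: H => //; split=> //; rewrite parameter_bernoulli //.
by rewrite mass_bernoulli ltrDl tolerance_gt0.
Qed.

Lemma extension_checkP w P (r : rat) b :
  (exists2 e, E e.1 e.2 & extension_check (e, (r, b))) ->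
  measure_basic b (w, P) -> ((ratr r)%:E < extension (w, P))%E.
Proof.
move: b => [x' cs] [[q [[x u] v]] Ee]; rewrite /extension_check.
have [r0 _ _|r0] := ltP r 0.
  by apply: lt_le_trans (extension_ge0 _); rewrite lte_fin ltrq0.
rewrite orFb => /and4P[rq /eqP -> cs3 /and5P[/eqP c1 /eqP c2 /eqP c3 c3' hP]].
(* Conditions after the third only shrink the basic set. *)
case: cs cs3 c1 c2 c3 c3' hP => [|k1 [|[[y2 a] b] [|[[y3 l] h] cs]]] //= _.
move=> -> -> -> l0 hP [wx bP].
have {}bP y (u' v' : rat) : (y, u', v') \in [:: ([:: true], u, v),
    ([:: true], a, b), (x, l, h) & cs] -> ratr u' < mass P y < ratr v'.
  by move=> /bP /=; rewrite massE !lte_fin.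
have q0 : 0 < q.
  by rewrite -pnum_gt0 lt0n; apply: contraTneq rq => ->; rewrite mul0n.
have puv := bP [:: true] u v; have pab := bP [:: true] a b.
have {}puv : ratr u < mass P [:: true] < ratr v by apply: puv; rewrite mem_head.
have /andP[pa pb] : ratr a < mass P [:: true] < ratr b.
  by apply: pab; rewrite !inE eqxx orbT.
have /andP[_ Ph] : ratr l < mass P x < ratr h.
  by apply: bP; rewrite !inE eqxx !orbT.
apply: lt_le_trans (item_height_le_extension (e := (q, (x, u, v))) _ _) => //.
  rewrite lte_fin /item_height /= ltr_pdivlMr//.
  have -> : ratr q = (pnum q)%:R / (pden q)%:R :> R.
    by rewrite pfrac max_r// ler0q ltW.
  have -> : ratr r = (pnum r)%:R / (pden r)%:R :> R.
    by rewrite pfrac max_r// ler0q.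
  rewrite mulrAC -natrM ltr_natfrac ?pden_gt0//.
  by rewrite [(_ * 4)%N]mulnC.
split=> //=; rewrite /item_word /=.
apply: (lt_le_trans Ph); have w0 := tolerance_gt0 (e := (q, (x, u, v))) q0.
have W0 : (0 < tolerance_den (q, (x, u, v)))%N by rewrite -(ltr0n R) -invr_gt0.
apply: (@le_trans _ _ (low_bound (ratr a) (ratr b) x +
  tolerance (q, (x, u, v)))).
  rewrite low_bound_add_tolerance//.
  apply: (@le_trans _ _ (Num.max 0 (ratr h))).
    by rewrite le_max lexx orbT.
  by rewrite -pfrac ler_natfrac ?pden_gt0// muln_gt0 low_den_gt0.
by rewrite lerD2r; apply: low_bound_le => //; rewrite ?mass_ge0 ?mass_le1.
Qed.

(** An active item satisfies its mass condition strictly; this gap leaves room for a rational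
    bracket [(a, b)] of [P(1)] and a rational bound [h] of [P(x)]. *)
Lemma extension_check_exists w P (r : rat) :
  ((ratr r)%:E < extension (w, P))%E ->
  exists2 b, exists2 e, E e.1 e.2 & extension_check (e, (r, b)) &
    measure_basic b (w, P).
Proof.
have [r0 _|r0] := ltP r 0.
  (* The whole space serves as basic set, but it still has to be produced from some element of [E];
     level [-1] supplies one because [t] is nonnegative. *)
  have : [set wp | ((ratr (-1))%:E < t wp)%E] (w, parameter P).
    by apply: lt_le_trans (t_ge0 _); rewrite lte_fin ltrq0.
  rewrite tE => -[b Eb _]; exists ([::], [::]); last by split=> //.
  exists (-1, b) => //; case: b {Eb} => -[x u] v.
  by rewrite /extension_check r0.
move=> /extension_gt; rewrite ler0q => /(_ r0)[[q [[x u] v]]].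
move=> [[/= Ee q0 puv Px] wx rq].
set e := (q, (x, u, v)) in Px wx rq; rewrite /item_word /= in Px wx.
set p := (parameter P)%:num in puv Px.
have p0 : 0 <= p by exact: mass_ge0.
have p1 : p <= 1 by exact: mass_le1.
(* With a bracket narrower than [d], [low_bound] falls short of [B_p(x)] by less than the gap. *)
pose d := (bernoulli_mass p x + tolerance e - mass P x) / (size x).+1%:R.
have s0 : 0 < (size x).+1%:R :> R by rewrite ltr0n.
have d0 : 0 < d by rewrite divr_gt0// subr_gt0.
have [|a] := @rat_in_itvoo R (p - d / 2) p; first by lra.
rewrite in_itv /= => /andP[a1 a2].
have [|b] := @rat_in_itvoo R p (p + d / 2); first by lra.
rewrite in_itv /= => /andP[b1 b2].
have lowP : mass P x < low_bound (ratr a) (ratr b) x + tolerance e.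
  have := low_bound_near x p0 p1 a2 b1.
  have : (size x)%:R * (ratr b - ratr a) <=
      (ratr b - ratr a) * (size x).+1%:R :> R.
    by rewrite mulrC ler_wpM2l ?ler_nat//; lra.
  have : (ratr b - ratr a) * (size x).+1%:R <
      bernoulli_mass p x + tolerance e - mass P x.
    by rewrite -ltr_pdivlMr// -/d; lra.
  by lra.
have [h] := rat_in_itvoo lowP; rewrite in_itv /= => /andP[h1 h2].
(* The lower bound [-1] is vacuous for a probability, which makes the third condition one-sided. *)
exists (x, [:: ([:: true], u, v); ([:: true], a, b); (x, -1, h)]).
  exists e => //; rewrite /extension_check /e ltNge r0 /= -/e.
  have w0 := tolerance_gt0 (e := e) q0.
  have W0 : (0 < tolerance_den e)%N by rewrite -(ltr0n R) -invr_gt0.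
  rewrite !eqxx /=; apply/andP; split.
  - move: rq; rewrite /item_height /= ltr_pdivlMr//.
    have -> : ratr q = (pnum q)%:R / (pden q)%:R :> R.
      by rewrite pfrac max_r// ler0q ltW.
    have -> : ratr r = (pnum r)%:R / (pden r)%:R :> R.
      by rewrite pfrac max_r// ler0q.
    rewrite mulrAC -natrM ltr_natfrac ?pden_gt0//.
    by rewrite [(_ * 4)%N]mulnC.
  - rewrite -(ler_natfrac R) ?pden_gt0//; last first.
      by rewrite muln_gt0 low_den_gt0.
    rewrite -low_bound_add_tolerance// pfrac ge_max (ltW h2).
    by rewrite addr_ge0 ?low_bound_ge0 ?tolerance_ge0.
split=> // y u' v'; rewrite !inE massE !lte_fin.
case/or3P => /eqP[-> -> ->] //; first by rewrite a2 b1.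
by rewrite h1 andbT; apply: lt_le_trans (mass_ge0 P x); rewrite ltrq0.
Qed.

Lemma extension_test :
  enumerable [set rb : rat * (seq bool * rat * rat) | E rb.1 rb.2] ->
  uniform_test extension.
Proof.
move=> Een; split; [|exact: extension_ge0|exact: integral_extension].
exists (fun r b => exists2 e, E e.1 e.2 & extension_check (e, (r, b))).
  have := enumerable_image _ Een computable_extension_check.
  have -> : [set rb : rat * _ | exists2 e, E e.1 e.2 &
      extension_check (e, (rb.1, rb.2))] =
    [set a | exists2 e, [set rb : rat * _ | E rb.1 rb.2] e &
      extension_check (e, a)].
    by apply/seteqP; split=> -[r b].
  apply; apply: is_code_pair is_code_rat _.
  apply: is_code_pair is_code_rat; apply: is_code_pair is_code_rat.
  exact: is_code_seq is_code_bool.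
move=> r; apply/seteqP; split=> [[w P]|[w P] [b Eb wPb]] /=.
  by move=> /extension_check_exists[b Eb wPb]; exists b.
exact: extension_checkP Eb wPb.
Qed.

End test.

End extension.

Theorem theorem13 (R : realType)
    (tM : Omega * probability Omega R -> \bar R)
    (tB : Omega * {i01 R} -> \bar R)
    (htM : universal (@uniform_test R) tM)
    (htB : universal (@uniform_bernoulli_test R) tB) :
  exists2 c : R, 0 < c &
    forall (w : Omega) (p : {i01 R}),
      ((c^-1)%:E * tB (w, p) <= tM (w, bernoulli p) <= c%:E * tB (w, p))%E.
Proof.
have [tMt tMmax] := htM; have [tBt tBmax] := htB.
have [c1 c10 tM_le] := tBmax _ (restriction_test tMt).
have [[E Een tE] tB0 tBi] := tBt.
have [c2 c20 ext_le] := tMmax _ (extension_test tB0 tBi tE Een).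
have tM0 wP : (0 <= tM wP)%E by case: tMt => _ + _; exact.
(* [c1] comes from maximality of [tB] against the restriction of [tM]; [4 * c2] comes from
   [tB <= 4 * extension] at Bernoulli measures and maximality of [tM] against the extension. *)
exists (Num.max c1 (4 * c2)); first by rewrite lt_max c10.
move=> w p; apply/andP; split.
  rewrite muleC lee_pdivrMr; last by rewrite lt_max c10.
  apply: (le_trans (le_extension tE w p)).
  apply: (@le_trans _ _ (4%:E * (c2%:E * tM (w, bernoulli p)))%E).
    by apply: lee_wpmul2l => //; exact: ext_le.
  rewrite muleA -EFinM muleC; apply: lee_wpmul2l => //.
  by rewrite lee_fin le_max lexx orbT.
apply: (le_trans (tM_le (w, p))); apply: lee_wpmul2r => //.
by rewrite lee_fin le_max lexx.
Qed.
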